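(* There exist a set $A \subseteq \mathbb{N}$ which is explicit, in the sense that there is a deterministic algorithm which, given $n \in \mathbb{N}$, decides whether $n \in A$ in time $(\log n)^{O(1)}$ (polynomial in the number of digits of $n$), and absolute constants $C, c > 0$, such that $\sigma_A(n) \ge 1$ for every $n \in \mathbb{N}$, and $\sigma_A(n) \le C\, n^{c/\log\log n}$ for every $n \in \mathbb{N}$ with $n \ge 3$.
   Context: $\mathbb{N} = \{0,1,2,\ldots\}$. For $A \subseteq \mathbb{N}$ and $n \in \mathbb{N}$, $\sigma_A(n)$ denotes the number of ordered pairs $(a,a') \in A \times A$ with $a + a' = n$. In particular, $\sigma_A(n) \ge 1$ for all $n$ means $A + A = \mathbb{N}$. *)

(* Defs.v *)
From mathcomp Require Import all_boot all_order all_algebra.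
From mathcomp Require Import reals exp.

Set Implicit Arguments.
Unset Strict Implicit.
Unset Printing Implicit Defensive.

(* A two-way infinite tape; [before] lists the cells to the left of the head,
   nearest first, [after] those to its right.  Cells beyond the lists are
   blank. *)
Record tape (S : Type) := Tape { before : seq S; scanned : S; after : seq S }.

Inductive move := MoveLeft | Stay | MoveRight.

Definition write_move (S : Type) (blank s : S) (m : move) (t : tape S) :
    tape S :=
  match m with
  | MoveLeft =>
      Tape (behead (before t)) (head blank (before t)) (s :: after t)
  | Stay => Tape (before t) s (after t)
  | MoveRight =>
      Tape (s :: before t) (head blank (after t)) (behead (after t))
  end.

(* Deterministic Turing machine with [ntapes.+1] tapes.  [verdict q = Some b]
   means that [q] is a halting state with answer [b] (true = accept). *)
Record turing_machine := TuringMachine {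
  ntapes : nat;
  state : finType;
  symbol : finType;
  blank : symbol;
  digit : bool -> symbol;
  digit_inj : injective digit;
  digit_neq_blank : forall b, digit b != blank;
  start : state;
  verdict : state -> option bool;
  transition : state -> {ffun 'I_ntapes.+1 -> symbol} ->
    state * {ffun 'I_ntapes.+1 -> symbol * move}
}.

Definition config (M : turing_machine) : Type :=
  state M * {ffun 'I_(ntapes M).+1 -> tape (symbol M)}.

Definition step (M : turing_machine) (c : config M) : config M :=
  let: (q, ts) := c in
  if verdict q is Some _ then c else
  let: (q', act) := transition q [ffun i => scanned (ts i)] in
  (q', [ffun i => write_move (blank M) (act i).1 (act i).2 (ts i)]).

Definition word_tape (M : turing_machine) (w : seq bool) : tape (symbol M) :=
  let s := [seq digit M b | b <- w] in
  Tape [::] (head (blank M) s) (behead s).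

(* The input is on tape 0, with the head on its first digit. *)
Definition init_config (M : turing_machine) (w : seq bool) : config M :=
  (start M, [ffun i => word_tape M (if i == ord0 then w else [::])]).

Definition answers_within (M : turing_machine) (w : seq bool) (t : nat)
    (b : bool) : Prop :=
  exists2 k : nat, k <= t & verdict (iter k (@step M) (init_config M w)).1 = Some b.

(* Usual binary expansion, most significant digit first; the expansion of 0 is
   the one-digit word 0 (as [trunc_log 2 0 = 0]). *)
Definition binary (n : nat) : seq bool :=
  rev [seq odd (n %/ 2 ^ i) | i <- iota 0 (trunc_log 2 n).+1].

Definition polytime_decidable (A : {pred nat}) : Prop :=
  exists (M : turing_machine) (a d : nat), forall n : nat,
    answers_within M (binary n) (a * size (binary n) ^ d) (n \in A).

(* The summands of n are at most n, hence range over 'I_n.+1. *)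
Definition sigma (A : {pred nat}) (n : nat) : nat :=
  #|[set p : 'I_n.+1 * 'I_n.+1 |
      [&& (p.1 : nat) \in A, (p.2 : nat) \in A & p.1 + p.2 == n]]|.

(* Main.v *)
Require Import Defs.
From mathcomp Require Import all_boot all_order all_algebra zify ring lra.
From mathcomp Require Import boolp reals sequences exp.

Set Implicit Arguments.
Unset Strict Implicit.
Unset Printing Implicit Defensive.

(** Write a natural number in a mixed radix whose digits are blocks of binary
    digits: the [i]-th block has length [2 l], where [2^l] is the power of two in
    [(p, 2p]] for a prime [p] of size between about [sqrt i] and [i].  Put [n] in
    the set when every block, except for those at the top of [n], lies in a set
    [D_p] of residues modulo [q^2], [q = 2^l], such that [D_p + D_p] is everything
    while no residue has more than a constant number of representations.

    As in Ruzsa's construction, [D_p] is made of the points [(x, k x^2)] of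
    [F_p x F_p] read in radix [q], with a bounded set of shifts by multiples of [p]
    and [q p] that compensate for the difference between [p] and [q].  Three
    multipliers are used, [k = 2r, r(r+1), r+1] with [r] a nonresidue: solving
    [x + y = u], [k x^2 + k' y^2 = v] leads to the discriminant [v - r u^2], up to
    a square for [(k, k') = (r(r+1), r+1)] and up to [r] times a square for
    [k = k' = 2r], so one of the two equations is solvable, and each has at most
    two solutions because [k + k'] never vanishes.

    If [K] blocks fit in the binary expansion of [n], then [n] has [O(1)^K]
    representations, and [K = O(log n / log log n)] since the [i]-th block has
    length of order [log i]; the lower bound on the primes comes from
    [2^m <= 'C(2m, m) <= (2m)^P], where [P] bounds the primes up to [2m].

    Membership is tested by a program in which every natural number involved is
    polynomial in the length of the input, hence can be kept in unary as the
    position of the head of a tape. *)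

(** * Head-moving programs and their simulation by Turing machines *)

Notation sym := (bool * option bool)%type.

(* A state inspects one tape and moves the head of that tape only; [None] is the
   exit.  Programs never write: all the information is in the head positions. *)
Record prog := Prog {
  pst : finType;
  pini : pst;
  pnext : pst -> nat * (sym -> option pst * move)
}.

(* Cell 0 of each tape carries a mark, so that a head position can be compared with
   0; the input is on tape 0, the other tapes are otherwise blank. *)
Definition cell (w : seq bool) (i j : nat) : sym :=
  (j == 0, if i == 0 then onth w j else None).

Definition shift (m : move) (j : nat) : nat :=
  match m with MoveLeft => j.-1 | Stay => j | MoveRight => j.+1 end.

Definition upd (h : nat -> nat) (i v : nat) : nat -> nat :=
  fun x => if x == i then v else h x.

Definition pstep (p : prog) (w : seq bool) (c : option (pst p) * (nat -> nat)) :=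
  if c.1 is Some q then
    let: (i, d) := pnext q in
    let: (q', m) := d (cell w i (c.2 i)) in
    (q', upd c.2 i (shift m (c.2 i)))
  else c.

Definition steps (p : prog) w (c c' : option (pst p) * (nat -> nat)) (t : nat) :=
  exists2 n, n <= t & iter n (pstep w) c = c'.

Definition runs (p : prog) w h h' t :=
  steps w (Some (pini p), h) (None, h') t.

Lemma steps_trans p w (c1 c2 c3 : option (pst p) * _) t1 t2 :
  steps w c1 c2 t1 -> steps w c2 c3 t2 -> steps w c1 c3 (t1 + t2).
Proof.
move=> [n1 l1 <-] [n2 l2 <-]; exists (n2 + n1); last by rewrite iterD.
by rewrite addnC leq_add.
Qed.

Lemma steps1 p w (c c' : option (pst p) * _) :
  pstep w c = c' -> steps w c c' 1.
Proof. by move=> <-; exists 1. Qed.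

Lemma steps_le p w (c c' : option (pst p) * _) t t' :
  t <= t' -> steps w c c' t -> steps w c c' t'.
Proof. by move=> le_t [n ln E]; exists n => //; apply: leq_trans le_t. Qed.

Lemma steps_sim p1 p2 w (f : option (pst p1) -> option (pst p2)) :
  (forall q h, pstep w (f (Some q), h) =
     (f (pstep w (Some q, h)).1, (pstep w (Some q, h)).2)) ->
  forall c h' t, steps w c (None, h') t -> steps w (f c.1, c.2) (f None, h') t.
Proof.
move=> sim c h' t [n ln E].
suff [m lm Em] : exists2 m, m <= n & iter m (pstep w) (f c.1, c.2) = (f None, h').
  by exists m => //; apply: leq_trans ln.
elim: n {ln} c E => [c /= -> | n IHn [[q|] h]]; first by exists 0.
  rewrite iterSr => /IHn [m lm Em]; exists m.+1 => //.
  by rewrite iterSr sim.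
rewrite iterSr => /IHn [m lm Em]; exists m => //; exact: leqW.
Qed.

Definition pmove i m : prog :=
  @Prog unit tt (fun _ => (i, fun _ => (None, m))).

Definition pseq (p1 p2 : prog) : prog :=
  @Prog (pst p1 + pst p2)%type (inl (pini p1)) (fun x =>
    match x with
    | inl q => ((pnext q).1, fun s => let: (q', m) := (pnext q).2 s in
        (Some (if q' is Some q1 then inl q1 else inr (pini p2)), m))
    | inr q => ((pnext q).1, fun s => let: (q', m) := (pnext q).2 s in
        (omap inr q', m))
    end).

Definition pif i (test : pred sym) (p : prog) : prog :=
  @Prog (option (pst p)) None (fun x =>
    match x with
    | None => (i, fun s => (if test s then Some (Some (pini p)) else None, Stay))
    | Some q => ((pnext q).1, fun s => let: (q', m) := (pnext q).2 s in
        (omap some q', m))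
    end).

Definition pwhile i (test : pred sym) (p : prog) : prog :=
  @Prog (option (pst p)) None (fun x =>
    match x with
    | None => (i, fun s => (if test s then Some (Some (pini p)) else None, Stay))
    | Some q => ((pnext q).1, fun s => let: (q', m) := (pnext q).2 s in
        (Some q', m))
    end).

Lemma upd_id h i : upd h i (h i) = h.
Proof. by apply/funext => x; rewrite /upd; case: eqP => // ->. Qed.

Lemma runs_move w i m h : runs (pmove i m) w h (upd h i (shift m (h i))) 1.
Proof. exact: steps1. Qed.

Lemma runs_seq p1 p2 w h1 h2 h3 t1 t2 :
  runs p1 w h1 h2 t1 -> runs p2 w h2 h3 t2 -> runs (pseq p1 p2) w h1 h3 (t1 + t2).
Proof.
move=> R1 R2.
pose f1 (x : option (pst p1)) : option (pst (pseq p1 p2)) :=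
  Some (if x is Some q then inl q else inr (pini p2)).
pose f2 (x : option (pst p2)) : option (pst (pseq p1 p2)) := omap inr x.
apply: (@steps_trans _ _ _ (f1 None, h2)).
  apply: (steps_sim (f := f1) _ R1) => q h; rewrite /pstep /=.
  by case: (pnext q) => i d /=; case: (d _) => q' m.
apply: (steps_sim (f := f2) _ R2) => q h; rewrite /pstep /=.
by case: (pnext q) => i d /=; case: (d _) => q' m.
Qed.

Lemma runs_if_true (test : pred sym) p i w h h' t :
  test (cell w i (h i)) -> runs p w h h' t -> runs (pif i test p) w h h' t.+1.
Proof.
move=> T R; rewrite -add1n.
pose f (x : option (pst p)) : option (pst (pif i test p)) := omap some x.
apply: (@steps_trans _ _ _ (f (Some (pini p)), h)).
  by apply: steps1; rewrite /pstep /= T upd_id.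
apply: (steps_sim (f := f) _ R) => q h0; rewrite /pstep /=.
by case: (pnext q) => j d /=; case: (d _) => q' m.
Qed.

Lemma runs_if_false (test : pred sym) p i w h :
  ~~ test (cell w i (h i)) -> runs (pif i test p) w h h 1.
Proof. by move=> /negPf T; apply: steps1; rewrite /pstep /= T upd_id. Qed.

Lemma runs_while_false (test : pred sym) p i w h :
  ~~ test (cell w i (h i)) -> runs (pwhile i test p) w h h 1.
Proof. by move=> /negPf T; apply: steps1; rewrite /pstep /= T upd_id. Qed.

Lemma runs_while_true (test : pred sym) p i w h1 h2 h3 t1 t2 :
  test (cell w i (h1 i)) -> runs p w h1 h2 t1 ->
  runs (pwhile i test p) w h2 h3 t2 -> runs (pwhile i test p) w h1 h3 (t1.+1 + t2).
Proof.
move=> T R1 R2; rewrite -[t1.+1]add1n -addnA.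
pose f (x : option (pst p)) : option (pst (pwhile i test p)) := Some x.
apply: (@steps_trans _ _ _ (f (Some (pini p)), h1)).
  by apply: steps1; rewrite /pstep /= T upd_id.
apply: (@steps_trans _ _ _ (f None, h2)) => //.
apply: (steps_sim (f := f) _ R1) => q h0; rewrite /pstep /=.
by case: (pnext q) => j d /=; case: (d _) => q' m.
Qed.

Lemma runs_while (test : pred sym) p i w (hs : nat -> nat -> nat) n T :
  (forall j, j < n -> test (cell w i (hs j i)) /\ runs p w (hs j) (hs j.+1) T) ->
  ~~ test (cell w i (hs n i)) ->
  runs (pwhile i test p) w (hs 0) (hs n) (n * T.+1).+1.
Proof.
elim: n hs => [|n IHn] hs H Hn; first exact: runs_while_false.
rewrite mulSn -addnS; have [T0 R0] := H 0 isT.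
apply: runs_while_true T0 R0 _.
by apply: (IHn (fun j => hs j.+1)) => // j ltj; apply: H.
Qed.

Lemma runs_le p w h h' t t' : t <= t' -> runs p w h h' t -> runs p w h h' t'.
Proof. exact: steps_le. Qed.

Section Machine.
Variables (p : prog) (K : nat).

(* At the left end [write_move] would shift the contents of the tape instead of
   leaving the head in place. *)
Definition guard (m : move) (b : bool) : move :=
  if b then (if m is MoveLeft then Stay else m) else m.

Definition tm_trans (x : option (pst p) + option bool)
    (v : {ffun 'I_K.+2 -> sym}) :
    (option (pst p) + option bool) * {ffun 'I_K.+2 -> sym * move} :=
  match x with
  | inr None =>
      (inl (Some (pini p)), [ffun i => ((true, (v i).2), Stay)])
  | inl (Some q) =>
      let: (i, d) := pnext q in
      let: (q', m) := d (v (inord i)) in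
      (inl q', [ffun j : 'I_K.+2 =>
                  (v j, if (j : nat) == i then guard m (v j).1 else Stay)])
  | inl None => (inr (Some (~~ (v (inord 1)).1)), [ffun j => (v j, Stay)])
  | inr (Some b) => (inr (Some b), [ffun j => (v j, Stay)])
  end.

Definition tm_verdict (x : option (pst p) + option bool) : option bool :=
  if x is inr o then o else None.

Definition tm : turing_machine.
Proof.
refine (@TuringMachine K.+1 (option (pst p) + option bool)%type sym
  (false, None) (fun b => (false, Some b)) _ _ (inr None) tm_verdict tm_trans).
- by move=> a b [].
- by [].
Defined.

Definition tape_rep (c : nat -> sym) (h : nat) (t : tape sym) :=
  size (before t) = h /\
  forall j, nth (false, None) (rev (before t) ++ scanned t :: after t) j = c j.

Lemma tape_rep_scanned c h t : tape_rep c h t -> scanned t = c h.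
Proof.
by case=> <- /(_ (size (before t))) <-; rewrite nth_cat size_rev ltnn subnn.
Qed.

Lemma tape_rep_move c h t m : tape_rep c h t -> (c h).1 = (h == 0) ->
  tape_rep c (shift m h)
    (write_move (false, None) (scanned t) (guard m (scanned t).1) t).
Proof.
move=> R; rewrite (tape_rep_scanned R) => E; rewrite E -(tape_rep_scanned R).
case: t R E => b s a [/= Sb C] E.
case: m.
- case: h Sb E => [|h] Sb E //=; case: b Sb C => [|x b] //= [Sb] C; split=> //=.
  by move=> j; rewrite -C rev_cons cat_rcons.
- by case: (h == 0).
- have -> : guard MoveRight (h == 0) = MoveRight by case: (h == 0).
  split=> /=; first by rewrite Sb.
  move=> j; rewrite -C rev_cons cat_rcons; case: a C => [|x a] //= _.
  have -> : rev b ++ [:: s; (false, None)] = rcons (rev b ++ [:: s]) (false, None).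
    by rewrite rcons_cat.
  rewrite nth_rcons; case: ltngtP => // le_j; last by rewrite le_j nth_default.
  by rewrite nth_default // ltnW.
Qed.

Definition conf_rep w (c : option (pst p) * (nat -> nat)) (x : config tm) :=
  x.1 = inl c.1 /\ forall i : 'I_K.+2, tape_rep (cell w i) (c.2 i) (x.2 i).

Hypothesis pK : forall q : pst p, (pnext q).1 < K.+2.

Lemma conf_rep_step w (c : option (pst p) * (nat -> nat)) x :
  c.1 -> conf_rep w c x ->
  conf_rep w (pstep w c) (step x).
Proof.
case: c => [[q|] // h] _; case: x => [_ ts] [/= -> R]; rewrite /pstep /=.
have := pK q; case: (pnext q) => i d /= ltiK.
rewrite ffunE (tape_rep_scanned (R _)) inordK //.
case: (d _) => q' m; split=> //= j; rewrite ffunE ffunE ffunE /upd /=.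
case: eqP => [<-|_]; first exact: tape_rep_move.
by case: (ts j) (R j).
Qed.

Lemma conf_rep_iter w n c h' x : conf_rep w c x ->
  iter n (pstep w) c = (None, h') ->
  exists2 m, m <= n & conf_rep w (None, h') (iter m (@step tm) x).
Proof.
elim: n c x => [|n IHn] c x Rcx; first by move=> /= <-; exists 0.
rewrite iterSr; case Ec: c.1 => [q|].
  move=> /(IHn _ (step x)) []; first by apply: conf_rep_step; rewrite ?Ec.
  by move=> m lm Rm; exists m.+1 => //; rewrite iterSr.
have -> : pstep w c = c by rewrite /pstep Ec.
by case/(IHn _ x) => // m lm Rm; exists m => //; apply: leqW.
Qed.

Lemma conf_rep_init w : 
  conf_rep w (Some (pini p), fun=> 0) (step (init_config tm w)).
Proof.
split=> //= i; rewrite ffunE ffunE !ffunE /=.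
rewrite /word_tape /=; split=> //= j; rewrite -val_eqE /= /cell.
case: (val i) => [|i0] /=.
  case: w => [|b w]; case: j => [|j] //=; first by rewrite nth_nil.
  by elim: w j => [|b' w IHw] [|j] //=; rewrite ?nth_nil ?IHw.
by case: j => [|j] //=; rewrite nth_nil.
Qed.

Lemma tm_answers w h' t : runs p w (fun=> 0) h' t ->
  answers_within tm w t.+2 (h' 1 != 0).
Proof.
case=> n ln E; have [m lm [R1 R2]] := conf_rep_iter (conf_rep_init w) E.
exists m.+2; first by rewrite !ltnS (leq_trans lm).
rewrite iterS iterSr.
case: (iter _ _ _) R1 R2 => [_ ts] /= -> R /=.
by rewrite ffunE (tape_rep_scanned (R _)) inordK.
Qed.

End Machine.

(** * Functions computed in polynomial time *)

(* The summand 2 makes every constant at most a power of [nrm]. *)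
Definition nrm (w : seq bool) (rho : seq nat) : nat := (size w + sumn rho).+2.

Definition poly_bounded (g : seq bool -> seq nat -> nat) : Prop :=
  exists d, forall w rho, g w rho <= nrm w rho ^ d.

Lemma nrm_gt1 w rho : 1 < nrm w rho. Proof. by []. Qed.

Lemma bounded_le g g' : (forall w rho, g w rho <= g' w rho) -> poly_bounded g' ->
  poly_bounded g.
Proof. by move=> le_g [d H]; exists d => w rho; apply: leq_trans (H _ _). Qed.

Lemma bounded_const c : poly_bounded (fun _ _ => c).
Proof.
exists c => w rho; apply: leq_trans (ltnW (ltn_expl c (nrm_gt1 w rho))) _.
by [].
Qed.

Lemma bounded_nrm : poly_bounded nrm. Proof. by exists 1 => w rho;
  rewrite expn1. Qed.

Lemma bounded_mul f g : poly_bounded f -> poly_bounded g ->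
  poly_bounded (fun w rho => f w rho * g w rho).
Proof.
by move=> [d H] [e H']; exists (d + e) => w rho; rewrite expnD leq_mul.
Qed.

Lemma bounded_add f g : poly_bounded f -> poly_bounded g ->
  poly_bounded (fun w rho => f w rho + g w rho).
Proof.
move=> [d H] [e H']; exists (d + e).+1 => w rho; rewrite expnS.
have H1 := H w rho; have H2 := H' w rho.
have le1 : nrm w rho ^ d <= nrm w rho ^ (d + e) by rewrite leq_pexp2l // leq_addr.
have le2 : nrm w rho ^ e <= nrm w rho ^ (d + e) by rewrite leq_pexp2l // leq_addl.
apply: (@leq_trans (2 * nrm w rho ^ (d + e))); first by lia.
by rewrite leq_mul2r nrm_gt1 orbT.
Qed.

Lemma bounded_succ f : poly_bounded f -> poly_bounded (fun w rho => (f w rho).+1).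
Proof.
move=> /bounded_add /(_ (bounded_const 1)); apply: bounded_le => w rho;
  by rewrite addn1.
Qed.

Lemma bounded_exp f d : poly_bounded f -> poly_bounded (fun w rho => f w rho ^ d).
Proof.
move=> [e H]; exists (e * d) => w rho; rewrite expnM.
by case: d => // d; rewrite leq_exp2r.
Qed.

Lemma bounded_behead f : poly_bounded f ->
  poly_bounded (fun w rho => f w (behead rho)).
Proof.
move=> [d H]; exists d => w rho; apply: leq_trans (H _ _) _.
case: d {H} => // d; rewrite leq_exp2r // !ltnS leq_add2l.
by case: rho => //= x s; apply: leq_addl.
Qed.

Lemma bounded_nrm_cons x : poly_bounded x ->
  poly_bounded (fun w rho => nrm w (x w rho :: rho)).
Proof.
move=> Bx; apply: bounded_le (bounded_add Bx bounded_nrm) => w rho.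
by rewrite /nrm /= addnCA !addnS.
Qed.

(* Calling convention: the arguments [rho] of [f] are the head positions of the tapes
   [regs]; the tapes from [k] on are free, and the result goes to tape [k]. *)
Definition computable_with (f g : seq bool -> seq nat -> nat) : Prop :=
  forall k regs, 0 < k -> all (gtn k) regs -> exists p, forall w h,
    h 0 = 0 -> (forall i, k <= i -> h i = 0) ->
    runs p w h (upd h k (f w (map h regs))) (g w (map h regs)).

Definition polytime (f : seq bool -> seq nat -> nat) : Prop :=
  poly_bounded f /\ exists2 g, poly_bounded g & computable_with f g.

Definition nz (s : sym) : bool := ~~ s.1.

Definition pskip := pmove 0 Stay.
Definition pinc i := pmove i MoveRight.
Definition pdec i := pmove i MoveLeft.
Definition pclear i := pwhile i nz (pdec i).
Definition pmv i j := pwhile i nz (pseq (pdec i) (pinc j)).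
Definition pmv2 i j k := pwhile i nz (pseq (pdec i) (pseq (pinc j) (pinc k))).

Lemma runs_skip w h : runs pskip w h h 1.
Proof. by rewrite -{2}(upd_id h 0); apply: runs_move. Qed.

Lemma runs_eq p w h h1 h2 t1 t2 :
  runs p w h h1 t1 -> h1 = h2 -> t1 <= t2 -> runs p w h h2 t2.
Proof. by move=> R <- le_t; apply: runs_le R. Qed.

Ltac store := rewrite ?/shift; apply/funext => ?; rewrite /upd; 
  repeat (case: eqP => ?; subst); try lia.

Lemma runs_inc w h i : runs (pinc i) w h (upd h i (h i).+1) 1.
Proof. exact: runs_move. Qed.

Lemma runs_dec w h i : runs (pdec i) w h (upd h i (h i).-1) 1.
Proof. exact: runs_move. Qed.

Lemma runs_clear w h i : runs (pclear i) w h (upd h i 0) (h i * 2).+1.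
Proof.
pose hs j := upd h i (h i - j).
have -> : upd h i 0 = hs (h i) by rewrite /hs subnn.
rewrite -{1}[h](_ : hs 0 = h); last by rewrite /hs subn0 upd_id.
apply: runs_while => [j ltj|]; last by rewrite /hs /upd eqxx subnn.
split; first by rewrite /hs /nz /upd /= eqxx; lia.
by apply: runs_eq (runs_dec _ _ _) _ _ => //; rewrite /hs; store.
Qed.

Lemma runs_mv w h i j : i != j ->
  runs (pmv i j) w h (upd (upd h j (h j + h i)) i 0) (h i * 3).+1.
Proof.
move=> /eqP nij.
pose hs n := upd (upd h j (h j + n)) i (h i - n).
have -> : upd (upd h j (h j + h i)) i 0 = hs (h i) by rewrite /hs subnn.
rewrite -{1}[h](_ : hs 0 = h); last by rewrite /hs; store.
apply: runs_while => [n ltn|]; last by rewrite /hs /upd eqxx subnn.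
split; first by rewrite /hs /nz /upd /= eqxx; lia.
by apply: runs_eq (runs_seq (runs_dec _ _ _) (runs_inc _ _ _)) _ _ => //;
   rewrite /hs; store.
Qed.

Lemma runs_mv2 w h i j k : i != j -> i != k -> j != k ->
  runs (pmv2 i j k) w h (upd (upd (upd h j (h j + h i)) k (h k + h i)) i 0)
    (h i * 4).+1.
Proof.
move=> /eqP nij /eqP nik /eqP njk.
pose hs n := upd (upd (upd h j (h j + n)) k (h k + n)) i (h i - n).
have -> : upd (upd (upd h j (h j + h i)) k (h k + h i)) i 0 = hs (h i)
  by rewrite /hs subnn.
rewrite -{1}[h](_ : hs 0 = h); last by rewrite /hs; store.
apply: runs_while => [n ltn|]; last by rewrite /hs /upd eqxx subnn.
split; first by rewrite /hs /nz /upd /= eqxx; lia.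
by apply: runs_eq (runs_seq (runs_dec _ _ _) (runs_seq (runs_inc _ _ _)
  (runs_inc _ _ _))) _ _ => //;
   rewrite /hs; store.
Qed.

Lemma map_upd h k v regs : all (gtn k) regs -> map (upd h k v) regs = map h regs.
Proof.
move=> /allP H; apply/eq_in_map => r /H /=; rewrite /upd.
by case: eqP => // ->; rewrite ltnn.
Qed.

Lemma gtn_all k k' regs : k <= k' -> all (gtn k) regs -> all (gtn k') regs.
Proof. by move=> le_k; apply: sub_all => r /= ltr; apply: leq_trans le_k. Qed.

Lemma polytime_zero : polytime (fun _ _ => 0).
Proof.
split; first exact: bounded_const.
exists (fun _ _ => 1); first exact: bounded_const.
move=> k regs k0 _; exists pskip => w h h0 hk.
by apply: runs_eq (runs_skip w h) _ _ => //; rewrite -(hk k) // upd_id.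
Qed.

Lemma polytime_head : polytime (fun _ rho => head 0 rho).
Proof.
split; first by exists 1 => w [|x rho] //=; rewrite expn1 /nrm /=; lia.
exists (fun _ rho => (head 0 rho * 7).+2).
  do 2![apply: bounded_succ]; apply: bounded_mul (bounded_const 7).
  by exists 1 => w [|x rho] //=; rewrite expn1 /nrm /=; lia.
move=> k [|r regs] k0 /= => [_|/andP[ltr _]].
  exists pskip => w h h0 hk.
  by apply: runs_eq (runs_skip w h) _ _ => //; rewrite -(hk k) // upd_id.
exists (pseq (pmv2 r k k.+1) (pmv k.+1 r)) => w h h0 hk.
have hk0 := hk k (leqnn _); have hk1 := hk k.+1 (leqnSn _).
apply: runs_eq (runs_seq (runs_mv2 w h _ _ _) (runs_mv w _ _)) _ _; try lia.
  by store.
by rewrite /upd; repeat case: eqP => /= ?; lia.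
Qed.

Lemma polytime_weak f : polytime f -> polytime (fun w rho => f w (behead rho)).
Proof.
move=> [Bf [g Bg H]]; split; first exact: bounded_behead.
exists (fun w rho => g w (behead rho)); first exact: bounded_behead.
move=> k regs k0 Hr; have [|p Hp] := H k (behead regs) k0.
  by case: regs Hr => //= r regs /andP[].
by exists p => w h h0 hk; rewrite behead_map; apply: Hp.
Qed.

Lemma polytime_succ f : polytime f -> polytime (fun w rho => (f w rho).+1).
Proof.
move=> [Bf [g Bg H]]; split; first exact: bounded_succ.
exists (fun w rho => (g w rho).+1); first exact: bounded_succ.
move=> k regs k0 Hr; have [p Hp] := H k regs k0 Hr.
exists (pseq p (pinc k)) => w h h0 hk.
apply: runs_eq (runs_seq (Hp w h h0 hk) (runs_inc _ _ _)) _ _; last lia.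
by store.
Qed.

Lemma polytime_let f b : polytime f ->
  polytime (fun w rho => b w (behead rho) (head 0 rho)) ->
  polytime (fun w rho => b w rho (f w rho)).
Proof.
move=> [Bf [g Bg H]] [[d Bb] [g' [e Bg'] H']]; split.
  apply: bounded_le (bounded_exp d (bounded_nrm_cons Bf)) => w rho.
  exact: (Bb w (f w rho :: rho)).
exists (fun w rho => g w rho + (nrm w (f w rho :: rho) ^ e +
          (f w rho * 2 + nrm w (f w rho :: rho) ^ d * 3 + 2))).
  apply: bounded_add => //; apply: bounded_add;
    first exact: bounded_exp (bounded_nrm_cons _).
  apply: bounded_add (bounded_const _); apply: bounded_add.
    exact: bounded_mul Bf (bounded_const _).
  exact: bounded_mul (bounded_exp _ (bounded_nrm_cons _)) (bounded_const _).
move=> k regs k0 Hr; have [p Hp] := H k regs k0 Hr.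
have [||p' Hp'] := H' k.+1 (k :: regs); rewrite ?ltnS ?leqnn //=.
  by rewrite leqnn (gtn_all _ Hr).
exists (pseq p (pseq p' (pseq (pclear k) (pmv k.+1 k)))) => w h h0 hk.
have hk1 := hk k.+1 (leqnSn _).
set rho := map h regs; set v := f w rho.
have R1 := Hp w h h0 hk; rewrite -/rho -/v in R1.
have h0' : upd h k v 0 = 0 by rewrite /upd; case: eqP => //; lia.
have hk' i : k < i -> upd h k v i = 0.
  by move=> lti; rewrite /upd gtn_eqF // hk // ltnW.
have R2 := Hp' w _ h0' hk'.
rewrite /= map_upd // -/rho (_ : upd h k v k = v) /= in R2;
  last by rewrite /upd eqxx.
set u := b w rho v in R2 *.
have R3 := runs_clear w (upd (upd h k v) k.+1 u) k.
have R4 := @runs_mv w (upd (upd (upd h k v) k.+1 u) k 0) k.+1 k.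
apply: runs_eq (runs_seq R1 (runs_seq R2 (runs_seq R3 (R4 _)))) _ _.
- by rewrite gtn_eqF.
- by store.
have leu : u <= nrm w (v :: rho) ^ d := Bb w (v :: rho).
have leg : g' w (v :: rho) <= nrm w (v :: rho) ^ e := Bg' w (v :: rho).
by rewrite /upd; repeat (case: eqP => ?); lia.
Qed.

Definition isdigit (s : sym) : bool := s.2 != None.

Definition prewind k := pwhile k nz (pseq (pdec k) (pdec 0)).

Lemma runs_rewind w h k : 0 < k ->
  runs (prewind k) w h (upd (upd h 0 (h 0 - h k)) k 0) (h k * 3).+1.
Proof.
move=> k0; pose hs n := upd (upd h 0 (h 0 - n)) k (h k - n).
have -> : upd (upd h 0 (h 0 - h k)) k 0 = hs (h k) by rewrite /hs subnn.
rewrite -{1}[h](_ : hs 0 = h); last by rewrite /hs; store.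
apply: runs_while => [n ltn|]; last by rewrite /hs /upd eqxx subnn.
split; first by rewrite /hs /nz /upd /= eqxx; lia.
by apply: runs_eq (runs_seq (runs_dec _ _ _) (runs_dec _ _ _)) _ _ => //;
   rewrite /hs; store.
Qed.

Lemma polytime_size : polytime (fun w _ => size w).
Proof.
split; first by exists 1 => w rho; rewrite expn1 /nrm; lia.
exists (fun w _ => (size w * 7).+2).
  by apply: (bounded_le (g' := fun w rho => nrm w rho * 7))
    (bounded_mul bounded_nrm (bounded_const _));
     move=> w rho; rewrite /nrm; lia.
move=> k regs k0 _.
exists (pseq (pwhile 0 isdigit (pseq (pinc 0) (pseq (pinc k) (pinc k.+1))))
             (prewind k.+1)) => w h h0 hk.
have hk0 := hk k (leqnn _); have hk1 := hk k.+1 (leqnSn _).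
pose hs n := upd (upd (upd h 0 n) k n) k.+1 n.
have R1 : runs (pwhile 0 isdigit (pseq (pinc 0) (pseq (pinc k) (pinc k.+1))))
    w h (hs (size w)) (size w * 4).+1.
  rewrite -{1}[h](_ : hs 0 = h); last by rewrite /hs; store.
  have hs0 n : hs n 0 = n by rewrite /hs /upd /= ltn_eqF.
  apply: runs_while => [n ltn|]; rewrite hs0 /isdigit /=.
    split; first by elim: (w) n ltn => [|b w' IHw] [|n] //=; apply: IHw.
    apply: runs_eq (runs_seq (runs_inc _ _ _)
             (runs_seq (runs_inc _ _ _) (runs_inc _ _ _))) _ _ => //.
    by rewrite /hs; store.
  by elim: (w).
apply: runs_eq (runs_seq R1 (runs_rewind w _ _)) _ _ => //.
  by rewrite /hs; store.
by rewrite /hs /upd eqxx; lia.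
Qed.

Definition isone (s : sym) : bool := s.2 == Some true.

Lemma polytime_bit f : polytime f ->
  polytime (fun w rho => nth false w (f w rho) : nat).
Proof.
move=> [Bf [g Bg H]]; split; first by apply: bounded_le (bounded_const 1)
  => w rho; apply: leq_b1.
exists (fun w rho => g w rho + (f w rho * 7 + 4)).
  apply: bounded_add => //; apply: bounded_add (bounded_const _);
    exact: bounded_mul Bf (bounded_const _).
move=> k regs k0 Hr; have [p Hp] := H k regs k0 Hr.
exists (pseq p (pseq (pmv2 k 0 k.+1) (pseq (pif 0 isone (pinc k)) (prewind k.+1)))).
move=> w h h0 hk.
have hk0 := hk k (leqnn _); have hk1 := hk k.+1 (leqnSn _).
set rho := map h regs; set v := f w rho.
have R1 := Hp w h h0 hk; rewrite -/rho -/v in R1.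
have R2 := @runs_mv2 w (upd h k v) k 0 k.+1.
pose h2 := upd (upd h 0 v) k.+1 v.
have R3 : runs (pif 0 isone (pinc k)) w h2 (upd h2 k (nth false w v)) 2.
  have E0 : h2 0 = v by rewrite /h2 /upd.
  have E : isone (cell w 0 (h2 0)) = nth false w v.
    rewrite E0 /isone /=; elim: (w) (v) => [|b w' IHw] [|v'] //=; by case: b.
  case: (boolP (nth false w v)) => Eb.
    apply: runs_eq (runs_if_true _ (runs_inc _ _ _)) _ _; rewrite ?E //.
    by rewrite /h2; store.
  apply: runs_eq (runs_if_false _ _) _ _; rewrite ?E //.
  by rewrite /h2; store.
have R4 := @runs_rewind w (upd h2 k (nth false w v)) k.+1.
apply: runs_eq (runs_seq R1 (runs_seq (runs_eq (R2 _ _ _) _ (leqnn _))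
  (runs_seq R3 (R4 _)))) _ _ => //.
- by rewrite gtn_eqF.
- by rewrite ltn_eqF.
- by rewrite /h2; store.
- by rewrite /h2; store.
by rewrite /h2 /upd; repeat (case: eqP => ?); lia.
Qed.

Lemma polytime_iteri a b F B : polytime a -> polytime b ->
  polytime (fun w rho => F w (behead (behead rho)) (head 0 (behead rho))
    (head 0 rho)) ->
  poly_bounded B -> (forall w rho j, j <= a w rho ->
    iteri j (F w rho) (b w rho) <= B w rho) ->
  polytime (fun w rho => iteri (a w rho) (F w rho) (b w rho)).
Proof.
move=> [Ba [ga Bga Ha]] [Bb [gb Bgb Hb]] [_ [gF [e BgF] HF]] BB leB.
split; first by apply: bounded_le BB => w rho; apply: leB.
pose N w rho := nrm w rho + a w rho + B w rho.
have BN : poly_bounded N by apply: bounded_add => //; apply: bounded_add => //;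
  apply: bounded_nrm.
exists (fun w rho => gb w rho + (ga w rho +
   ((a w rho * (N w rho ^ e + B w rho * 5 + 4).+1).+1 + (a w rho * 2).+1))).
  do 2![apply: bounded_add => //]; apply: bounded_add; apply: bounded_succ;
    last exact: bounded_mul (bounded_const _).
  apply: bounded_mul => //; apply: bounded_succ;
    apply: bounded_add (bounded_const _).
  by apply: bounded_add; [exact: bounded_exp | exact: bounded_mul (bounded_const _)].
move=> k regs k0 Hr; have [p1 Hp1] := Hb k regs k0 Hr.
have [|p2 Hp2] := Ha k.+1 regs isT; first exact: gtn_all Hr.
have [|p3 Hp3] := HF k.+3 [:: k, k.+2 & regs] isT.
  by rewrite /= ltnSn (gtn_all _ Hr) ?andbT; lia.
pose body := pseq (pdec k.+1) (pseq p3 (pseq (pclear k) (pseq (pmv k.+3 k)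
  (pinc k.+2)))).
exists (pseq p1 (pseq p2 (pseq (pwhile k.+1 nz body) (pclear k.+2)))) => w h h0 hk.
set rho := map h regs.
set A := a w rho; set f := F w rho; set x := b w rho.
have R1 := Hp1 w h h0 hk; rewrite -/rho -/x in R1.
pose hs j := upd (upd (upd h k (iteri j f x)) k.+1 (A - j)) k.+2 j.
have hk1 := hk k.+1; have hk2 := hk k.+2; have hk3 := hk k.+3.
have R2 : runs p2 w (upd h k x) (hs 0) (ga w rho).
  have := Hp2 w (upd h k x); rewrite map_upd // => R2.
  apply: runs_eq (R2 _ _) _ _ => //.
  - by rewrite /upd; case: eqP => //; lia.
  - by move=> i lti; rewrite /upd gtn_eqF // hk // ltnW.
  by rewrite /hs /= -/rho -/A; store.
have R3 : runs (pwhile k.+1 nz body) w (hs 0) (hs A)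
    (A * (N w rho ^ e + B w rho * 5 + 4).+1).+1.
  have hsk j : hs j k.+1 = A - j by rewrite /hs /upd; repeat (case: eqP => ?); lia.
  apply: runs_while => [j ltj|]; last by rewrite hsk /nz /= subnn.
  split; first by rewrite hsk /nz /=; lia.
  set acc := iteri j f x.
  have leacc : acc <= B w rho by apply: leB; apply: ltnW.
  have leacc' : f j acc <= B w rho by have := leB w rho j.+1 ltj.
  pose h1 := upd (upd (upd h k acc) k.+1 (A - j.+1)) k.+2 j.
  have E1 : upd (hs j) k.+1 (hs j k.+1).-1 = h1.
    by rewrite /hs /h1 -/acc; store.
  have Q2 := Hp3 w h1.
  have E2 : map h1 [:: k, k.+2 & regs] = [:: acc, j & rho].
    have E3 i : k <= i -> all (gtn i) regs by move=> lei; apply: gtn_all Hr.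
    rewrite /= /h1 !map_upd ?E3 //; try lia.
    by congr [:: _, _ & _]; rewrite /upd; repeat (case: eqP => ?); lia.
  rewrite E2 /= in Q2.
  have {}Q2 : runs p3 w h1 (upd h1 k.+3 (f j acc)) (N w rho ^ e).
    apply: runs_eq (Q2 _ _) _ _ => //.
    - by rewrite /h1 /upd; repeat (case: eqP => ?); lia.
    - move=> i lti; rewrite /h1 /upd; repeat (case: eqP => ?); try lia.
      by apply: hk; lia.
    apply: leq_trans (BgF _ _) _; case: (e) => // e'; rewrite leq_exp2r //.
    by rewrite /N /nrm /=; lia.
  have Q3 := runs_clear w (upd h1 k.+3 (f j acc)) k.
  have Q4 := @runs_mv w (upd (upd h1 k.+3 (f j acc)) k 0) k.+3 k.
  rewrite /body; apply: runs_eq (runs_seq (runs_eq (runs_dec _ _ _) E1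
    (leqnn _)) (runs_seq Q2 (runs_seq Q3 (runs_seq (Q4 _) (runs_inc _ _ _))))) _ _.
  - by rewrite gtn_eqF //; lia.
  - by rewrite /hs /h1 /= -/acc; store.
  by rewrite /h1 /upd; repeat (case: eqP => ?); lia.
apply: runs_eq (runs_seq R1 (runs_seq R2 (runs_seq R3 (runs_clear _ _ _)))) _ _.
  by rewrite /hs; store.
by rewrite /hs /upd eqxx -/A; lia.
Qed.

Lemma polytime_decidable_of (f : seq bool -> nat) (A : {pred nat}) :
  polytime (fun w _ => f w) -> (forall n, (n \in A) = (f (binary n) != 0)) ->
  polytime_decidable A.
Proof.
move=> [_ [g [d Bg] H]] fA; have [p Hp] := H 1 [::] isT isT.
pose K := \max_q (@pnext p q).1.
have pK q : (@pnext p q).1 < K.+2.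
  by rewrite !ltnS leqW // /K; by apply: (bigmax_sup q).
exists (tm p K), (3 ^ d).+2, d => n; set w := binary n.
have sz : 0 < size w by rewrite /w /binary size_rev size_map size_iota.
have := tm_answers pK (Hp w (fun=> 0) (erefl _) (fun _ _ => erefl _)).
rewrite /upd /= -fA => -[t lt E]; exists t => //; apply: leq_trans lt _.
apply: (@leq_trans (3 ^ d * size w ^ d).+2).
  rewrite !ltnS -expnMn; apply: leq_trans (Bg _ _) _.
  by case: (d) => // d'; rewrite leq_exp2r // /nrm /=; lia.
by have := expn_gt0 (size w) d; rewrite sz /=; lia.
Qed.

Lemma polytime_ext f g : (forall w rho, f w rho = g w rho) -> polytime f ->
  polytime g.
Proof. by move=> E; rewrite (_ : f = g) //; do 2!apply/funext => ?. Qed.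

Definition polytime1 (F : seq bool -> nat -> nat) : Prop :=
  polytime (fun w rho => F w (head 0 rho)).
Definition polytime2 (F : seq bool -> nat -> nat -> nat) : Prop :=
  polytime (fun w rho => F w (head 0 (behead rho)) (head 0 rho)).
Definition polytime3 (F : seq bool -> nat -> nat -> nat -> nat) : Prop :=
  polytime (fun w rho => F w (head 0 (behead (behead rho)))
                         (head 0 (behead rho)) (head 0 rho)).
Definition polytime4 (F : seq bool -> nat -> nat -> nat -> nat -> nat) : Prop :=
  polytime (fun w rho => F w (head 0 (behead (behead (behead rho))))
     (head 0 (behead (behead rho))) (head 0 (behead rho)) (head 0 rho)).

Lemma call1 F f : polytime1 F -> polytime f -> polytime (fun w rho => F w (f w rho)).
Proof. by move=> HF Hf; apply: (polytime_let (b := fun w _ x => F w x)). Qed.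

Lemma call2 F f g : polytime2 F -> polytime f -> polytime g ->
  polytime (fun w rho => F w (f w rho) (g w rho)).
Proof.
move=> HF Hf Hg.
apply: (polytime_let (b := fun w rho x => F w x (g w rho))) => //.
apply: (polytime_let (f := fun w rho => g w (behead rho))
                 (b := fun w rho x => F w (head 0 rho) x)) => //.
exact: polytime_weak.
Qed.

Lemma call3 F f g e : polytime3 F -> polytime f -> polytime g -> polytime e ->
  polytime (fun w rho => F w (f w rho) (g w rho) (e w rho)).
Proof.
move=> HF Hf Hg He.
apply: (polytime_let (b := fun w rho x => F w x (g w rho) (e w rho))) => //.
apply: (polytime_let (f := fun w rho => g w (behead rho))
   (b := fun w rho x => F w (head 0 rho) x (e w (behead rho)))).
  exact: polytime_weak.
apply: (polytime_let (f := fun w rho => e w (behead (behead rho)))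
   (b := fun w rho x => F w (head 0 (behead rho)) (head 0 rho) x)) => //.
exact: (polytime_weak (polytime_weak He)).
Qed.

Lemma call4 F f g e c : polytime4 F -> polytime f -> polytime g -> polytime e ->
  polytime c ->
  polytime (fun w rho => F w (f w rho) (g w rho) (e w rho) (c w rho)).
Proof.
move=> HF Hf Hg He Hc.
apply: (polytime_let (b := fun w rho x => F w x (g w rho) (e w rho)
  (c w rho))) => //.
apply: (polytime_let (f := fun w rho => g w (behead rho))
   (b := fun w rho x => F w (head 0 rho) x (e w (behead rho)) (c w (behead rho)))).
  exact: polytime_weak.
apply: (polytime_let (f := fun w rho => e w (behead (behead rho)))
   (b := fun w rho x => F w (head 0 (behead rho)) (head 0 rho) x
                          (c w (behead (behead rho))))).
  exact: (polytime_weak (polytime_weak He)).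
apply: (polytime_let (f := fun w rho => c w (behead (behead (behead rho))))
   (b := fun w rho x => F w (head 0 (behead (behead rho)))
                            (head 0 (behead rho)) (head 0 rho) x)) => //.
exact: (polytime_weak (polytime_weak (polytime_weak Hc))).
Qed.

Lemma polytime_v0 : polytime (fun _ rho => head 0 rho).
Proof. exact: polytime_head. Qed.
Lemma polytime_v1 : polytime (fun _ rho => head 0 (behead rho)).
Proof. exact: polytime_weak polytime_v0. Qed.
Lemma polytime_v2 : polytime (fun _ rho => head 0 (behead (behead rho))).
Proof. exact: polytime_weak polytime_v1. Qed.
Lemma polytime_v3 : polytime (fun _ rho => head 0 (behead (behead (behead rho)))).
Proof. exact: polytime_weak polytime_v2. Qed.
Lemma polytime_v4 : polytime (fun _ rho => head 0 (behead (behead (behead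
  (behead rho))))).
Proof. exact: polytime_weak polytime_v3. Qed.
Lemma polytime_v5 :
  polytime (fun _ rho => head 0 (behead (behead (behead (behead (behead rho)))))).
Proof. exact: polytime_weak polytime_v4. Qed.
Lemma polytime_v6 : polytime (fun _ rho =>
  head 0 (behead (behead (behead (behead (behead (behead rho))))))).
Proof. exact: polytime_weak polytime_v5. Qed.

Lemma polytime_const c : polytime (fun _ _ => c).
Proof. by elim: c => [|c IH]; [exact: polytime_zero | exact: polytime_succ IH]. Qed.

Lemma polytime_bounded f : polytime f -> poly_bounded f. Proof. by case. Qed.

Lemma polytime_pred f : polytime f -> polytime (fun w rho => (f w rho).-1).
Proof.
move=> Hf; apply: (call1 (F := fun _ x => x.-1)) => //.
apply: (polytime_ext (f := fun w rho => iteri (head 0 rho) (fun i _ => i) 0)).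
  by move=> w [|[|x] s].
apply: (@polytime_iteri _ _ (fun _ _ i _
  => i) _ polytime_v0 polytime_zero polytime_v1 (polytime_bounded polytime_v0)).
by move=> w rho [|j] //=; apply: ltnW.
Qed.

Lemma polytime_add f g : polytime f -> polytime g ->
  polytime (fun w rho => f w rho + g w rho).
Proof.
move=> Hf Hg.
have E w rho : forall j, iteri j (fun _ a => a.+1) (f w rho) = f w rho + j.
  by elim=> [|j IH] /=; rewrite ?addn0 // IH addnS.
apply: (polytime_ext (f := fun w rho => iteri (g w rho) (fun _ a => a.+1)
  (f w rho))).
  by move=> w rho; rewrite E.
apply: (@polytime_iteri _ _ (fun _ _ _ a => a.+1) _ Hg Hf (polytime_succ polytime_v0)
          (bounded_add (polytime_bounded Hf) (polytime_bounded Hg))).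
by move=> w rho j lej; rewrite E leq_add2l.
Qed.

Lemma polytime_sub f g : polytime f -> polytime g ->
  polytime (fun w rho => f w rho - g w rho).
Proof.
move=> Hf Hg.
have E w rho : forall j, iteri j (fun _ a => a.-1) (f w rho) = f w rho - j.
  by elim=> [|j IH] /=; rewrite ?subn0 // IH subnS.
apply: (polytime_ext (f := fun w rho => iteri (g w rho) (fun _ a => a.-1)
  (f w rho))).
  by move=> w rho; rewrite E.
apply: (@polytime_iteri _ _ (fun _ _ _ a => a.-1) _ Hg Hf
  (polytime_pred polytime_v0) (polytime_bounded Hf)).
by move=> w rho j lej; rewrite E leq_subr.
Qed.

Lemma polytime_mul f g : polytime f -> polytime g ->
  polytime (fun w rho => f w rho * g w rho).
Proof.
move=> Hf Hg; apply: (call2 (F := fun _ => muln)) => // {f g Hf Hg}.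
have E x : forall j, iteri j (fun _ a => a + x) 0 = x * j.
  by elim=> [|j IH] /=; rewrite ?muln0 // IH mulnS addnC.
apply: (polytime_ext (f := fun w rho =>
    iteri (head 0 rho) (fun _ a => a + head 0 (behead rho)) 0)).
  by move=> w rho; rewrite E.
apply: (@polytime_iteri _ _ (fun _ rho _ a => a + head 0 (behead rho)) _ polytime_v0
  polytime_zero (polytime_add polytime_v0 polytime_v3) (bounded_mul
    (polytime_bounded polytime_v1) (polytime_bounded polytime_v0))).
by move=> w rho j lej; rewrite E leq_mul2l lej orbT.
Qed.

Notation polytimeb P := (polytime (fun w rho => nat_of_bool (P w rho))).

Lemma polytime_eq0 f : polytime f -> polytimeb (fun w rho => f w rho == 0).
Proof.
move=> Hf; apply: polytime_ext (polytime_sub (polytime_const 1) Hf) => w rho.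
by case: (f w rho).
Qed.

Lemma polytime_leq f g : polytime f -> polytime g ->
  polytimeb (fun w rho => f w rho <= g w rho).
Proof. by move=> Hf Hg; apply: polytime_eq0 (polytime_sub Hf Hg). Qed.

Lemma polytime_and P Q : polytimeb P -> polytimeb Q ->
  polytimeb (fun w rho => P w rho && Q w rho).
Proof.
by move=> HP HQ; apply: polytime_ext (polytime_mul HP HQ) => w rho; rewrite mulnb.
Qed.

Lemma polytime_not P : polytimeb P -> polytimeb (fun w rho => ~~ P w rho).
Proof.
by move=> HP; apply: polytime_ext (polytime_eq0 HP) => w rho; case: (P w rho).
Qed.

Lemma polytime_or P Q : polytimeb P -> polytimeb Q ->
  polytimeb (fun w rho => P w rho || Q w rho).
Proof.
move=> HP HQ; apply: polytime_ext (polytime_not (polytime_and (polytime_not HP)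
  (polytime_not HQ))) => w rho.
by rewrite negb_and !negbK.
Qed.

Lemma polytime_imply P Q : polytimeb P -> polytimeb Q ->
  polytimeb (fun w rho => P w rho ==> Q w rho).
Proof.
move=> HP HQ; apply: polytime_ext (polytime_or (polytime_not HP) HQ) => w rho.
by rewrite implybE.
Qed.

Lemma polytime_eq f g : polytime f -> polytime g ->
  polytimeb (fun w rho => f w rho == g w rho).
Proof.
move=> Hf Hg; apply: polytime_ext (polytime_and (polytime_leq Hf Hg)
  (polytime_leq Hg Hf)) => w rho.
by rewrite eqn_leq.
Qed.

Lemma polytime_if P f g : polytimeb P -> polytime f -> polytime g ->
  polytime (fun w rho => if P w rho then f w rho else g w rho).
Proof.
move=> HP Hf Hg.
apply: polytime_ext (polytime_add (polytime_mul HP Hf) (polytime_mul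
  (polytime_not HP) Hg)) => w rho.
by case: (P w rho); rewrite /= ?mul1n ?mul0n ?addn0.
Qed.

Lemma polytime_has n P : polytime n ->
  polytimeb (fun w rho => P w (behead rho) (head 0 rho)) ->
  polytimeb (fun w rho => has (P w rho) (iota 0 (n w rho))).
Proof.
move=> Hn HP.
have E w rho j : iteri j (fun i a => (0 < a) || P w rho i : nat) 0
    = has (P w rho) (iota 0 j).
  elim: j => // j IH; rewrite -[in RHS]addn1 iotaD has_cat /= IH orbF.
  by case: (has _ _).
apply: (polytime_ext (f := fun w rho =>
    iteri (n w rho) (fun i a => (0 < a) || P w rho i : nat) 0)).
  by move=> w rho; rewrite E.
apply: (@polytime_iteri _ _ (fun w rho i a => (0 < a) || P w rho i : nat)
  (fun _ _ => 1)) => //.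
- exact: polytime_zero.
- apply: polytime_or; first exact: polytime_leq (polytime_const 1) polytime_v0.
  exact: polytime_weak HP.
- exact: bounded_const.
by move=> w rho j lej; rewrite E leq_b1.
Qed.

Lemma polytime_all n P : polytime n ->
  polytimeb (fun w rho => P w (behead rho) (head 0 rho)) ->
  polytimeb (fun w rho => all (P w rho) (iota 0 (n w rho))).
Proof.
move=> Hn HP.
have := polytime_has (P := fun w rho i => ~~ P w rho i) Hn (polytime_not HP).
move/polytime_not; apply: polytime_ext => w rho; rewrite has_predC negbK //.
Qed.

Lemma polytime_sum n f : polytime n ->
  polytime (fun w rho => f w (behead rho) (head 0 rho)) ->
  polytime (fun w rho => \sum_(0 <= i < n w rho) f w rho i).
Proof.
move=> Hn Hf; have [d Bf] := polytime_bounded Hf.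
have E w rho j : iteri j (fun i a => a + f w rho i) 0 = \sum_(0 <= i < j) f w rho i.
  elim: j => [|j IH] /=; first by rewrite big_geq.
  by rewrite IH big_nat_recr.
apply: (polytime_ext (f := fun w rho => iteri (n w rho) (fun i a
  => a + f w rho i) 0)).
  by move=> w rho; rewrite E.
apply: (@polytime_iteri _ _ (fun w rho i a => a + f w rho i)
          (fun w rho => n w rho * nrm w (n w rho :: rho) ^ d)) => //.
- exact: polytime_zero.
- exact: polytime_add polytime_v0 (polytime_weak Hf).
- exact: bounded_mul (polytime_bounded Hn) (bounded_exp _ (bounded_nrm_cons
  (polytime_bounded Hn))).
move=> w rho j lej; rewrite E.
apply: (@leq_trans (\sum_(0 <= i < j) nrm w (n w rho :: rho) ^ d)).
  rewrite big_nat_cond [leqRHS]big_nat_cond;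
    apply: leq_sum => i /andP[/andP[_ lti] _].
  apply: leq_trans (Bf w (i :: rho)) _; case: (d) => // d'.
  by rewrite leq_exp2r // /nrm /=; lia.
by rewrite sum_nat_const_nat subn0 leq_mul2r lej orbT.
Qed.

Lemma polytime_mod f g : polytime f -> polytime g ->
  polytime (fun w rho => f w rho %% g w rho).
Proof.
move=> Hf Hg; apply: (call2 (F := fun _ => modn)) => // {f g Hf Hg}.
have E d j : iteri j (fun _ a => if a.+1 == d then 0 else a.+1) 0 = j %% d.
  elim: j => [|j IH] /=; first by rewrite mod0n.
  rewrite IH; case: d {IH} => [|d]; first by rewrite !modn0.
  rewrite modnS; congr (if _ then _ else _).
  rewrite /dvdn -[j.+1]addn1 -modnDml addn1.
  have := ltn_pmod j (ltn0Sn d); rewrite leq_eqVlt.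
  case/predU1P=> [->|lt]; first by rewrite modnn !eqxx.
  by rewrite (modn_small lt) (ltn_eqF lt).
apply: (polytime_ext (f := fun w rho => iteri (head 0 (behead rho))
    (fun _ a => if a.+1 == head 0 rho then 0 else a.+1) 0)).
  by move=> w rho; rewrite E.
apply: (@polytime_iteri _ _ (fun _ rho _ a => if a.+1 == head 0 rho then 0 else a.+1)
   _ polytime_v1 polytime_zero _ (polytime_bounded polytime_v1)).
  exact: polytime_if (polytime_eq
    (polytime_succ polytime_v0) polytime_v2) polytime_zero
      (polytime_succ polytime_v0).
by move=> w rho j lej; rewrite E (leq_trans (leq_mod _ _)).
Qed.

(** * The set and its membership test *)

(* The largest prime below [i] that exceeds 10, or 11 if there is none. *)
Definition dprime (i : nat) : nat :=
  iteri i (fun j p => if prime j && (10 < j) then j else p) 11.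

Definition dlen (p : nat) : nat := trunc_log 2 (p + p).

(* The last three conditions keep the sums of two elements of [kset] nonzero. *)
Definition good_residue (p r : nat) : bool :=
  all (fun x => (x * x) %% p != r %% p) (iota 0 p) &&
  [&& (r + 1) %% p != 0, (r + 3) %% p != 0 & (3 * r + 1) %% p != 0].

Definition nonres (p : nat) : nat :=
  iteri p (fun j r => if good_residue p j then j else r) 0.

(* The multiples of [p] and [q * p] correct the sums of two points [(x, k x^2)],
   which are known modulo [p] only. *)
Definition parab (p q k a : nat) : bool :=
  has (fun x => has (fun j => has (fun j' =>
    a == (x + j * p + q * ((k * (x * x)) %% p + j' * p)) %% (q * q))
  (iota 0 3)) (iota 0 3)) (iota 0 p).

Definition dset (p a : nat) : bool :=
  let q := 2 ^ dlen p in let r := nonres p in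
  [|| parab p q (2 * r) a, parab p q (r * (r + 1)) a | parab p q (r + 1) a].

Definition dpos (i : nat) : nat := \sum_(0 <= j < i) 2 * dlen (dprime j).

(* [m] binary digits of the number written [w], from weight [2 ^ s] up, by Horner's
   rule; the cap has no effect but makes the value bounded for all arguments. *)
Definition word_bits (w : seq bool) (s m cap : nat) : nat :=
  iteri m (fun j a => minn cap (a * 2 + nth false w (size w - 1 - (s +
    (m - 1 - j))))) 0.

Definition accepts (w : seq bool) : bool :=
  all (fun i => (dpos (i + 1) + 2 <= size w) ==>
     let p := dprime i in
     dset p (word_bits w (dpos i) (2 * dlen p) (2 ^ dlen p * 2 ^ dlen p)))
   (iota 0 (size w)).

Ltac polytime_tac := lazy beta; lazymatch goal with
  | |- polytime (fun _ rho => head 0 rho) => exact polytime_v0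
  | |- polytime (fun _ rho => head 0 (behead rho)) => exact polytime_v1
  | |- polytime (fun _ rho => head 0 (behead (behead rho))) => exact polytime_v2
  | |- polytime (fun _ rho => head 0 (behead (behead (behead rho))))
      => exact polytime_v3
  | |- polytime (fun _ rho => head 0 (behead (behead (behead (behead rho))))) =>
      exact polytime_v4
  | |- polytime (fun _ rho => head 0 (behead (behead (behead (behead
      (behead rho)))))) =>
      exact polytime_v5
  | |- polytime (fun _ rho =>
         head 0 (behead (behead (behead (behead (behead (behead rho))))))) =>
      exact polytime_v6
  | |- polytime (fun w _ => size w) => exact polytime_size
  | |- polytime (fun _ _ => ?c) => exact (polytime_const c)
  | |- polytime (fun w rho => nat_of_bool (has (@?P w rho) (iota 0 (@?n w rho)))) =>
      apply (@polytime_has n P); polytime_tac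
  | |- polytime (fun w rho => nat_of_bool (all (@?P w rho) (iota 0 (@?n w rho)))) =>
      apply (@polytime_all n P); polytime_tac
  | |- polytime (fun w rho => nat_of_bool (@?P w rho && @?Q w rho)) =>
      apply (@polytime_and P Q); polytime_tac
  | |- polytime (fun w rho => nat_of_bool (@?P w rho || @?Q w rho)) =>
      apply (@polytime_or P Q); polytime_tac
  | |- polytime (fun w rho => nat_of_bool (~~ @?P w rho)) =>
      apply (@polytime_not P); polytime_tac
  | |- polytime (fun w rho => nat_of_bool (@eq_op _ (@?f w rho) (@?g w rho))) =>
      apply (@polytime_eq f g); polytime_tac
  | |- polytime (fun w rho => nat_of_bool (@?f w rho <= @?g w rho)) =>
      apply (@polytime_leq f g); polytime_tac
  | |- polytime (fun w rho => nat_of_bool (nth false w (@?f w rho))) =>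
      apply (@polytime_bit f); polytime_tac
  | |- polytime (fun w rho => @?f w rho %% @?g w rho) => apply
      (@polytime_mod f g); polytime_tac
  | |- polytime (fun w rho => @?f w rho * @?g w rho) => apply
      (@polytime_mul f g); polytime_tac
  | |- polytime (fun w rho => @?f w rho + @?g w rho) => apply
      (@polytime_add f g); polytime_tac
  | |- polytime (fun w rho => @?f w rho - @?g w rho) => apply
      (@polytime_sub f g); polytime_tac
  | |- polytime (fun w rho => (@?f w rho).+1) => apply (@polytime_succ f);
      polytime_tac
  | |- polytime (fun w rho => if _ then _ else _) => apply: polytime_if; polytime_tac
  | |- _ => idtac
  end.

Lemma polytime_prime f : polytime f -> polytimeb (fun w rho => prime (f w rho)).
Proof.
move=> Hf; apply: (call1 (F := fun _ x => nat_of_bool (prime x))) => //.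
apply: (polytime_ext (f := fun w rho => (1 < head 0 rho) &&
   all (fun d => [|| d == 1, d == head 0 rho | head 0 rho %% d != 0])
     (iota 0 (head 0 rho + 1)) : nat)).
  move=> w rho; set p := head 0 rho; congr nat_of_bool.
  apply/idP/primeP => [/andP[p1 /allP H]|[p1 H]].
    split=> // d dp; have := H d; rewrite mem_iota add0n addn1 ltnS.
    have -> : d <= p by apply: dvdn_leq => //; apply: ltnW.
    move=> /(_ isT).
    by move: dp; rewrite /dvdn => ->; rewrite orbF.
  rewrite p1; apply/allP => d _; case: (boolP (p %% d == 0)); rewrite ?orbT //.
  by move=> /H /= /orP[] ->; rewrite ?orbT.
by polytime_tac.
Qed.

Lemma dprime_le i : dprime i <= i + 11.
Proof.
rewrite /dprime; elim: i => //= i IH; case: ifP => _; lia.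
Qed.

Lemma polytime_dprime f : polytime f -> polytime (fun w rho => dprime (f w rho)).
Proof.
move=> Hf; apply: (call1 (F := fun _ => dprime)) => //.
apply: (@polytime_iteri _ _ (fun _ _ j p => if prime j && (10 < j) then j else p) _
  polytime_v0 (polytime_const 11) _ (bounded_add (polytime_bounded polytime_v0)
    (bounded_const 11))).
  apply: polytime_if (polytime_and
    (polytime_prime polytime_v1) _) polytime_v1 polytime_v0.
  by polytime_tac.
by move=> w rho j lej; apply: leq_trans (dprime_le j) _; rewrite leq_add2r.
Qed.

Definition pow2cap (p j : nat) : nat := iteri j (fun _ a
  => if a <= p then a + a else a) 1.

Lemma lt_dlen p j : (j < dlen p) = (2 ^ j <= p).
Proof.
case: p => [|p]; first by rewrite /dlen trunc_log0 ltn0 [RHS]leqNgt expn_gt0.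
have /andP[h1 h2] := @trunc_log_bounds 2 (p.+1 + p.+1) isT isT.
rewrite -/(dlen _) expnS in h1 h2 *; apply/idP/idP => H.
  have : 2 ^ j.+1 <= 2 ^ dlen p.+1 by rewrite leq_pexp2l.
  by rewrite expnS; lia.
rewrite ltnNge; apply/negP => H'.
have : 2 ^ dlen p.+1 <= 2 ^ j by rewrite leq_pexp2l.
lia.
Qed.

Lemma pow2cap_le p j : pow2cap p j <= (p + p).+1.
Proof. by elim: j => //= j; rewrite /pow2cap; case: ifP; lia. Qed.

Lemma pow2capE p j : pow2cap p j = 2 ^ minn j (dlen p).
Proof.
elim: j => [|j IH]; first by rewrite min0n.
rewrite {1}/pow2cap /= -/(pow2cap p j) IH; have [H|] := boolP (j < dlen p).
  rewrite (minn_idPl (ltnW H)) (minn_idPl H) -lt_dlen H expnS; lia.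
rewrite -leqNgt => H; rewrite (minn_idPr H) (minn_idPr (leqW H)).
by rewrite -lt_dlen ltnn.
Qed.

Lemma dlen_leq p : dlen p <= p.
Proof.
rewrite leqNgt lt_dlen -ltnNge; exact: ltn_expl.
Qed.

Lemma polytime_pow2cap f g : polytime f -> polytime g ->
  polytime (fun w rho => pow2cap (f w rho) (g w rho)).
Proof.
move=> Hf Hg; apply: (call2 (F := fun _ => pow2cap)) => //.
apply: (@polytime_iteri _ _ (fun _ rho _ a => if a <= head 0
  (behead rho) then a + a else a) _
  polytime_v0 (polytime_const 1) _ (bounded_succ (bounded_add
    (polytime_bounded polytime_v1) (polytime_bounded polytime_v1)))).
  by polytime_tac.
by move=> w rho j _; apply: pow2cap_le.
Qed.

Lemma polytime_dlen f : polytime f -> polytime (fun w rho => dlen (f w rho)).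
Proof.
move=> Hf; apply: (call1 (F := fun _ => dlen)) => //.
apply: (polytime_ext (f := fun w rho =>
  \sum_(0 <= j < head 0 rho) (pow2cap (head 0 rho) j <= head 0 rho))); last first.
  apply: polytime_sum; first exact: polytime_v0.
  by apply: polytime_leq; [apply: polytime_pow2cap|]; polytime_tac.
move=> w rho; set p := head 0 rho.
rewrite -[RHS]subn0 -[RHS]muln1 -sum_nat_const_nat.
rewrite (big_cat_nat (n := dlen p)) ?dlen_leq //= [X in _ + X]big1_seq ?addn0.
  apply: eq_big_nat => j /andP[_ lt].
  by rewrite pow2capE -lt_dlen gtn_min lt.
move=> j; rewrite mem_index_iota => /andP[_ /andP[le _]].
by rewrite pow2capE -lt_dlen (minn_idPr le) ltnn.
Qed.

Lemma polytime_pow2_dlen f : polytime f ->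
  polytime (fun w rho => 2 ^ dlen (f w rho)).
Proof.
move=> Hf; apply: polytime_ext (polytime_pow2cap Hf Hf) => w rho.
by rewrite pow2capE (minn_idPr (dlen_leq _)).
Qed.

Lemma polytime_nonres f : polytime f -> polytime (fun w rho => nonres (f w rho)).
Proof.
move=> Hf; apply: (call1 (F := fun _ => nonres)) => //.
apply: (@polytime_iteri _ _ (fun _ rho j r => if good_residue
  (head 0 rho) j then j else r) _
  polytime_v0 (polytime_const 0) _ (polytime_bounded polytime_v0)).
  by rewrite /good_residue; polytime_tac.
by move=> w rho; elim=> //= j IH lej; case: ifP => _;
  [exact: ltnW | exact: IH (ltnW lej)].
Qed.

Lemma polytime_parab f g e c : polytime f -> polytime g -> polytime e ->
  polytime c ->
  polytimeb (fun w rho => parab (f w rho) (g w rho) (e w rho) (c w rho)).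
Proof.
move=> Hf Hg He Hc.
apply: (call4 (F := fun _ p q k a => nat_of_bool (parab p q k a))) => //.
by rewrite /polytime4 /parab; polytime_tac.
Qed.

Lemma polytime_dset f g : polytime f -> polytime g ->
  polytimeb (fun w rho => dset (f w rho) (g w rho)).
Proof.
move=> Hf Hg; rewrite /dset; have Hr := polytime_nonres Hf.
have Hq := polytime_pow2_dlen Hf.
by apply: polytime_or; [|apply: polytime_or]; apply: polytime_parab => //;
  polytime_tac.
Qed.

Lemma polytime_dpos f : polytime f -> polytime (fun w rho => dpos (f w rho)).
Proof.
move=> Hf; apply: (call1 (F := fun _ => dpos)) => //; apply: polytime_sum;
  first exact: polytime_v0.
by apply: polytime_mul; [|apply/polytime_dlen/polytime_dprime]; polytime_tac.
Qed.

Lemma polytime_word_bits f g e : polytime f -> polytime g -> polytime e ->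
  polytime (fun w rho => word_bits w (f w rho) (g w rho) (e w rho)).
Proof.
move=> Hf Hg He; apply: (call3 (F := word_bits)) => //.
apply: (@polytime_iteri _ _ (fun w rho j a => minn (head 0 rho) (a * 2 + nth false w
  (size w - 1 - (head 0 (behead (behead rho)) + (head 0 (behead rho) - 1 - j))))) _
  polytime_v1 (polytime_const 0) _ (polytime_bounded polytime_v0)).
  by rewrite /minn; polytime_tac.
by move=> w rho [|j] _ //=; rewrite geq_minl.
Qed.

Lemma polytime_accepts : polytime (fun w _ => nat_of_bool (accepts w)).
Proof.
rewrite /accepts; apply: polytime_all; first exact: polytime_size.
have H := polytime_dlen (polytime_dprime polytime_v0).
have H' := polytime_pow2_dlen (polytime_dprime polytime_v0).
apply: polytime_imply.
  by apply: polytime_leq; [apply: polytime_add; [apply: polytime_dpos|]|];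
    polytime_tac.
apply: polytime_dset; first exact: polytime_dprime polytime_v0.
apply: polytime_word_bits.
- exact: polytime_dpos polytime_v0.
- by apply: polytime_mul => //; polytime_tac.
- exact: polytime_mul.
Qed.

Definition basis : {pred nat} := fun n => accepts (binary n).

Theorem basis_polytime : polytime_decidable basis.
Proof.
apply: (polytime_decidable_of polytime_accepts) => n; rewrite unfold_in /basis.
by case: (accepts _).
Qed.

Import Order.TTheory GRing.Theory Num.Theory.

Lemma nth_binary n b : b < size (binary n) ->
  nth false (binary n) (size (binary n) - 1 - b) = odd (n %/ 2 ^ b).
Proof.
rewrite /binary size_rev size_map size_iota => ltb.
rewrite nth_rev size_map size_iota; last by lia.
rewrite (nth_map 0) ?size_iota; last by lia.
rewrite nth_iota; last by lia.
by congr (odd (n %/ 2 ^ _)); lia.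
Qed.

Lemma word_bitsE n s m cap : s + m <= size (binary n) -> 2 ^ m <= cap ->
  word_bits (binary n) s m cap = (n %/ 2 ^ s) %% 2 ^ m.
Proof.
move=> les lec; rewrite /word_bits.
suff E j : j <= m -> iteri j (fun j a => minn cap (a * 2 + nth false (binary n)
    (size (binary n) - 1 - (s + (m - 1 - j))))) 0 = (n %/ 2 ^ (s + m - j)) %% 2 ^ j.
  by rewrite E // addnK.
elim: j => [|j IH] ltj; first by rewrite modn1.
rewrite /= IH ?(ltnW ltj) // nth_binary; last by lia.
have -> : s + m - j = (s + (m - 1 - j)).+1 by lia.
have -> : s + m - j.+1 = s + (m - 1 - j) by lia.
set t := s + _; rewrite expnSr divnMA; set N := n %/ 2 ^ t.
have -> : N %% 2 ^ j.+1 = (N %/ 2) %% 2 ^ j * 2 + odd N.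
  rewrite {1}(divn_eq N 2) modn2 expnSr.
  rewrite -modnDml -muln_modl modn_small //.
  have : (N %/ 2) %% 2 ^ j < 2 ^ j by rewrite ltn_pmod // expn_gt0.
  by move: (2 ^ j) (_ %% _) => u v; case: (odd N) => /=; clear; lia.
apply/minn_idPr; apply: leq_trans lec.
have : (N %/ 2) %% 2 ^ j < 2 ^ j by rewrite ltn_pmod // expn_gt0.
have : 2 ^ j.+1 <= 2 ^ m by rewrite leq_pexp2l.
rewrite expnS; move: (2 ^ m) (2 ^ j) (_ %% _) => u v z.
by case: (odd N) => /=; clear; lia.
Qed.

Definition digit_of (n i : nat) : nat :=
  (n %/ 2 ^ dpos i) %% 2 ^ (2 * dlen (dprime i)).

Lemma dposS i : dpos i.+1 = dpos i + 2 * dlen (dprime i).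
Proof. by rewrite /dpos big_nat_recr. Qed.

Lemma dprime_gt10 i : 10 < dprime i.
Proof. by rewrite /dprime; elim: i => //= i IH; case: ifP => // /andP[]. Qed.

Lemma dprime_prime i : prime (dprime i).
Proof. by rewrite /dprime; elim: i => //= i IH; case: ifP => // /andP[]. Qed.

Lemma dprime_max i j : prime j -> 10 < j < i -> j <= dprime i.
Proof.
move=> pj; rewrite /dprime; elim: i => [|i IH] /=; first by rewrite ltn0 andbF.
case/andP=> gtj; rewrite ltnS leq_eqVlt => /predU1P[<-|lt].
  by rewrite pj gtj.
case: ifP => _; first exact: ltnW.
by apply: IH; rewrite gtj.
Qed.

Lemma dlen_bounds p : 0 < p -> p < 2 ^ dlen p <= p + p.
Proof.
move=> p0; have /andP[-> _] := @trunc_log_bounds 2 (p + p) isT ltac:(lia).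
by rewrite ltnNge -lt_dlen ltnn.
Qed.

Lemma leq_dpos i : i <= dpos i.
Proof.
elim: i => // i IH; rewrite dposS; have := dprime_gt10 i.
have : 0 < dlen (dprime i) by rewrite lt_dlen; have := dprime_gt10 i; lia.
lia.
Qed.

Lemma dpos_mono i j : i <= j -> dpos i <= dpos j.
Proof.
move=> le; rewrite -(subnKC le); elim: (j - i) => [|m IH]; first by rewrite addn0.
by rewrite addnS dposS (leq_trans IH) ?leq_addr.
Qed.

Lemma basisP n :
  reflect (forall i, dpos i.+1 + 2 <= size (binary n) ->
                     dset (dprime i) (digit_of n i))
          (n \in basis).
Proof.
have E i : dpos i.+1 + 2 <= size (binary n) ->
  word_bits (binary n) (dpos i) (2 * dlen (dprime i))
    (2 ^ dlen (dprime i) * 2 ^ dlen (dprime i)) = digit_of n i.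
  rewrite dposS => le; rewrite word_bitsE //; first by lia.
  by rewrite -expnD leq_pexp2l //; lia.
rewrite unfold_in /basis /accepts; apply: (iffP allP) => H i.
  move=> le; have := H i; rewrite mem_iota addn1 le /= E //; apply.
  by have := leq_dpos i.+1; lia.
by move=> _; rewrite addn1; apply/implyP => le; rewrite /= E //; apply: H.
Qed.

(** * The digit sets modulo a prime *)

Section PrimeField.
Variable p : nat.
Hypotheses (p_prime : prime p) (p_gt10 : 10 < p).

Local Open Scope ring_scope.

Lemma Fp_eq (a b : nat) : (a%:R == b%:R :> 'F_p) = (a == b %[mod p])%N.
Proof. by rewrite -val_eqE /= !val_Fp_nat. Qed.

Lemma Fp_eq0 (a : nat) : (a%:R == 0 :> 'F_p) = (a %% p == 0)%N.
Proof. by rewrite (Fp_eq a 0) mod0n. Qed.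

Lemma Fp_lt (x : 'F_p) : (x < p)%N.
Proof. by have := ltn_ord x; rewrite [X in (_ < X)%N]Fp_cast. Qed.

Lemma Fp_natK (x : 'F_p) : (x : nat)%:R = x :> 'F_p.
Proof. exact: natr_Zp. Qed.

Lemma Fp_mod (a : nat) : (a %% p)%N%:R = a%:R :> 'F_p.
Proof. exact: Fp_nat_mod. Qed.

Lemma Fp_p : p%:R = 0 :> 'F_p.
Proof. by apply/eqP; rewrite Fp_eq0 modnn. Qed.

Lemma odd_p : odd p.
Proof. by case: (even_prime p_prime) => // E; move: p_gt10; rewrite E. Qed.

Lemma Fp2_neq0 : 2 != 0 :> 'F_p.
Proof. by rewrite (Fp_eq0 2) modn_small //; lia. Qed.

Lemma Fp_sqr_half (x : 'F_p) : exists2 a : nat, (a <= p./2)%N & x ^+ 2 = a%:R ^+ 2.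
Proof.
have := odd_p; have := odd_double_half p; move=> E Op; rewrite Op in E.
case: (leqP x p./2) => le; first by exists x => //; rewrite Fp_natK.
exists (p - x)%N; first by lia.
by rewrite natrB ?(ltnW (Fp_lt x)) // Fp_p sub0r sqrrN Fp_natK.
Qed.

Definition Fsquares : seq 'F_p := [seq a%:R ^+ 2 | a <- iota 0 (p./2).+1].

Lemma mem_Fsquares (x : 'F_p) : x ^+ 2 \in Fsquares.
Proof.
have [a le ->] := Fp_sqr_half x.
by apply/mapP; exists a => //; rewrite mem_iota ltnS le.
Qed.

Lemma Fsquares_inj (c : 'F_p) : c != 0 ->
  {in iota 0 (p./2).+1 &, injective (fun a : nat => c * a%:R ^+ 2)}.
Proof.
move=> c0 a b; rewrite !mem_iota !ltnS => la lb /(mulfI c0) /eqP.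
have := odd_p; have := odd_double_half p; move=> E Op; rewrite Op in E.
rewrite eqf_sqr Fp_eq -subr_eq0 opprK -natrD Fp_eq0.
by rewrite !modn_small; lia.
Qed.

Lemma good_residue_exists : exists2 r, (r < p)%N & good_residue p r.
Proof.
pose L := Fsquares ++ [:: -1; -3; - (3^-1)].
suff /hasP[x _ xL] : has (fun x => x \notin L) (enum 'F_p).
  exists x; first exact: Fp_lt.
  move: xL; rewrite mem_cat negb_or => /andP[nS].
  rewrite !inE !negb_or => /and3P[n1 n3 n13].
  apply/andP; split.
    apply/allP => y _ /=; rewrite -Fp_eq Fp_natK; apply: (contraNneq _ nS) => <-.
    by rewrite natrM -expr2 mem_Fsquares.
  rewrite -!Fp_eq0 (natrD _ _ 1) (natrD _ _ 3) (natrD _ _ 1) natrM Fp_natK.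
  apply/and3P; split.
  - by rewrite addr_eq0.
  - by rewrite addr_eq0.
  apply: contraNneq n13 => /eqP; rewrite addr_eq0 => /eqP E.
  have n3' : 3 != 0 :> 'F_p by rewrite (Fp_eq0 3) modn_small //; lia.
  by apply/eqP/(mulfI n3'); rewrite mulrN divff.
rewrite has_predC; apply/allP => sub.
have := uniq_leq_size (enum_uniq 'F_p) sub.
rewrite -cardE card_Fp // size_cat size_map size_iota /=.
have := odd_p; have := odd_double_half p; move=> E Op; rewrite Op in E; lia.
Qed.

Lemma nonres_good : good_residue p (nonres p).
Proof.
have [r ltr gr] := good_residue_exists.
rewrite /nonres; have : exists2 r, (r < p)%N & good_residue p r by exists r.
elim: {1 4}p => [|n IH] [s lts gs] //=.
case: ifP => // ng; apply: IH; exists s => //.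
by move: lts; rewrite ltnS leq_eqVlt => /predU1P[E|//]; rewrite E ng in gs.
Qed.

Let r : 'F_p := (nonres p)%:R.

Lemma nonres_nsquare (x : 'F_p) : x ^+ 2 != r.
Proof.
have /andP[/allP /(_ (x : nat)) H _] := nonres_good.
by rewrite -[x]Fp_natK expr2 -natrM Fp_eq H // mem_iota Fp_lt.
Qed.

Lemma nonres_neq0 : r != 0.
Proof. by have := nonres_nsquare 0; rewrite expr0n /= eq_sym. Qed.

Lemma nonres_conds : [/\ r + 1 != 0, r + 3 != 0 & 3 * r + 1 != 0].
Proof.
have /andP[_ /and3P[]] := nonres_good.
by rewrite -!Fp_eq0 (natrD _ _ 1) (natrD _ _ 3) (natrD _ _ 1) natrM.
Qed.

Lemma square_or_nonres (D : 'F_p) :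
  exists z, D = z ^+ 2 \/ D = r * z ^+ 2.
Proof.
pose L := Fsquares ++ [seq r * a%:R ^+ 2 | a <- iota 1 p./2].
have rI : {in iota 0 (p./2).+1 &, injective (fun a : nat => r * a%:R ^+ 2)}.
  exact: Fsquares_inj nonres_neq0.
have sI : {subset iota 1 p./2 <= iota 0 (p./2).+1}.
  by move=> a; rewrite !mem_iota; lia.
have uL : uniq L.
  rewrite cat_uniq !map_inj_in_uniq ?iota_uniq /= ?andbT.
  - apply/hasPn => _ /mapP[a la ->]; apply/negP => /mapP[b lb E].
    have a0 : a%:R != 0 :> 'F_p.
      have := odd_double_half p; rewrite odd_p => E'.
      by move: la; rewrite mem_iota Fp_eq0 => la; rewrite modn_small; lia.
    have := nonres_nsquare (b%:R / a%:R); rewrite exprMn -E exprVn.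
    by rewrite mulfK ?eqxx // expf_neq0.
  - by move=> a b /sI la /sI lb; apply: rI.
  - move=> a b la lb E; apply: (Fsquares_inj (oner_neq0 _)) => //.
    by rewrite /= !mul1r.
have [_ EL] : (size L = size (enum 'F_p)) * (L =i enum 'F_p).
  apply: uniq_min_size => // [x _|]; first by rewrite mem_enum.
  rewrite -cardE card_Fp // size_cat !size_map !size_iota.
  have := odd_p; have := odd_double_half p; move=> E Op; rewrite Op in E; lia.
have : D \in L by rewrite EL mem_enum.
by rewrite mem_cat => /orP[] /mapP[a _ ->]; exists a%:R; [left | right].
Qed.

Definition kset : seq nat :=
  let r := nonres p in [:: (2 * r)%N; (r * (r + 1))%N; (r + 1)%N].

Lemma ksetD_neq0 k1 k2 : k1 \in kset -> k2 \in kset -> (k1 + k2)%:R != 0 :> 'F_p.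
Proof.
have [c1 c3 c13] := nonres_conds; have r0 := nonres_neq0; have c2 := Fp2_neq0.
rewrite !inE => /or3P[] /eqP -> /or3P[] /eqP ->;
  rewrite !(natrD, natrM) -/r.
- by rewrite (_ : _ + _ = 2 * 2 * r) ?mulf_neq0 //; ring.
- by rewrite (_ : _ + _ = r * (r + 3)) ?mulf_neq0 //; ring.
- by rewrite (_ : _ + _ = 3 * r + 1) //; ring.
- by rewrite (_ : _ + _ = r * (r + 3)) ?mulf_neq0 //; ring.
- by rewrite (_ : _ + _ = 2 * r * (r + 1)) ?mulf_neq0 //; ring.
- by rewrite (_ : _ + _ = (r + 1) * (r + 1)) ?mulf_neq0 //; ring.
- by rewrite (_ : _ + _ = 3 * r + 1) //; ring.
- by rewrite (_ : _ + _ = (r + 1) * (r + 1)) ?mulf_neq0 //; ring.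
- by rewrite (_ : _ + _ = 2 * (r + 1)) ?mulf_neq0 //; ring.
Qed.

Lemma kset_cover (u v : 'F_p) : exists k1 k2, exists x y : 'F_p,
  [/\ k1 \in kset, k2 \in kset, x + y = u & k1%:R * x ^+ 2 + k2%:R * y ^+ 2 = v].
Proof.
have [c1 _ _] := nonres_conds; have c2 := Fp2_neq0.
have [z [E|E]] := square_or_nonres (v - r * u ^+ 2).
- exists (nonres p * (nonres p + 1))%N, (nonres p + 1)%N.
  exists ((u + z) / (r + 1)), ((r * u - z) / (r + 1)).
  rewrite !inE !eqxx ?orbT natrM natrD -/r; split=> //; first by field.
  have -> : v = z ^+ 2 + r * u ^+ 2 by rewrite -E subrK.
  by field.
exists (2 * nonres p)%N, (2 * nonres p)%N, ((u + z) / 2), ((u - z) / 2).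
rewrite !inE !eqxx natrM -/r; split=> //; first by field.
have -> : v = r * z ^+ 2 + r * u ^+ 2 by rewrite -E subrK.
by field.
Qed.

Definition Froots (a b c : 'F_p) : seq 'F_p :=
  [seq x <- enum 'F_p | a * x ^+ 2 + b * x + c == 0].

Lemma size_Froots (a b c : 'F_p) : a != 0 -> (size (Froots a b c) <= 2)%N.
Proof.
move=> a0; pose P := Poly [:: c; b; a].
have P0 : P != 0.
  apply: contra_neq a0 => E; have := congr1 (fun P : {poly _} => P`_2) E.
  by rewrite coef_Poly coef0.
rewrite -ltnS; apply: leq_trans (size_Poly [:: c; b; a]).
apply: max_poly_roots => //; last by rewrite filter_uniq // enum_uniq.
apply/allP => x; rewrite mem_filter => /andP[/eqP E _].
by rewrite /root horner_Poly /= mul0r add0r; apply/eqP; rewrite -[RHS]E; ring.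
Qed.

End PrimeField.

Lemma size_flatten_map (T : eqType) (U : Type) (F : T -> seq U) (l : seq T) c :
  (forall t, t \in l -> size (F t) <= c) ->
  size (flatten [seq F t | t <- l]) <= c * size l.
Proof.
elim: l => [|t l IH] H; first by rewrite muln0.
rewrite /= size_cat mulnS leq_add ?H ?mem_head // IH // => t' lt'.
by apply: H; rewrite inE lt' orbT.
Qed.

Lemma modn_subr (A T N M : nat) : 0 < M -> A + T = N %[mod M] ->
  A = N + (M - 1) * T %[mod M].
Proof.
move=> M0 E; rewrite -modnDml -E modnDml -addnA -mulSn.
by rewrite (_ : (M - 1).+1 = M) ?[M * T]mulnC ?modnMDl 1?addnC ?modnMDl //; lia.
Qed.

Section DigitSet.
Variable p : nat.
Hypotheses (p_prime : prime p) (p_gt10 : 10 < p).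
Let q := 2 ^ dlen p.

Lemma p_lt_q : p < q <= p + p.
Proof. by apply: dlen_bounds; lia. Qed.

Definition point (k x j j' : nat) : nat :=
  (x + j * p + q * ((k * (x * x)) %% p + j' * p)) %% (q * q).

Lemma dsetP a : reflect (exists k x j j',
    [/\ k \in kset p, x < p, j < 3, j' < 3 & a = point k x j j'])
  (dset p a).
Proof.
have -> : dset p a = has (fun k => parab p q k a) (kset p) by rewrite /= orbF.
apply: (iffP hasP) => [[k kS]|[k [x [j [j' [kS lx lj lj' E]]]]]].
  case/hasP=> x; rewrite mem_iota => lx; case/hasP=> j; rewrite mem_iota => lj.
  by case/hasP=> j'; rewrite mem_iota => lj' /eqP E; exists k, x, j, j'.
exists k => //; apply/hasP; exists x; first by rewrite mem_iota.
apply/hasP; exists j; first by rewrite mem_iota.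
by apply/hasP; exists j'; [rewrite mem_iota | apply/eqP].
Qed.

Lemma window s u : s < 2 * p -> u < 2 * p -> s = u %[mod p] ->
  exists2 j, j < 3 & s + j * p = u + p.
Proof.
move=> ls lu E; have p0 : 0 < p by lia.
have := divn_eq s p; have := divn_eq u p; rewrite E.
have : s %/ p < 2 by rewrite ltn_divLR.
have : u %/ p < 2 by rewrite ltn_divLR.
case: (s %/ p) => [|[|//]]; case: (u %/ p) => [|[|//]] _ _ Eu Es.
- by exists 1 => //; lia.
- by exists 2 => //; lia.
- by exists 0 => //; lia.
- by exists 1 => //; lia.
Qed.

Lemma dset_cover nu : exists a b,
  [/\ a < q * q, b < q * q, dset p a, dset p b & a + b = nu %[mod q * q]].
Proof.
have /andP[pq qp] := p_lt_q; have p0 : 0 < p by lia.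
have q0 : 0 < q * q by rewrite muln_gt0; lia.
pose T := p + q * p; pose N := (nu + (q * q - 1) * T) %% (q * q).
have ltN : N < q * q by rewrite ltn_mod.
have EN : N + T = nu %[mod q * q].
  rewrite /N modnDml -addnA -mulSnr (_ : (q * q - 1).+1 = q * q); last by lia.
  by rewrite addnC [_ * T]mulnC modnMDl.
pose u := N %% q; pose v := N %/ q.
have lu : u < q by rewrite ltn_mod; lia.
have lv : v < q by rewrite ltn_divLR //; lia.
have [k1 [k2 [x [y [k1S k2S Exy Ek]]]]] := kset_cover p_prime p_gt10 u%:R%R v%:R%R.
have lx := Fp_lt p_prime x; have ly := Fp_lt p_prime y.
pose Y1 := (k1 * (x * x)) %% p; pose Y2 := (k2 * (y * y)) %% p.
have lY1 : Y1 < p by rewrite ltn_mod.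
have lY2 : Y2 < p by rewrite ltn_mod.
have [j lj Ej] : exists2 j, j < 3 & (x + y) + j * p = u + p.
  apply: window; [by clear -lx ly; lia | by clear -lu qp; lia | apply/eqP].
  by rewrite -(Fp_eq p_prime) natrD !Fp_natK Exy.
have [j' lj' Ej'] : exists2 j, j < 3 & (Y1 + Y2) + j * p = v + p.
  apply: window; [by clear -lY1 lY2; lia | by clear -lv qp; lia | apply/eqP].
  by rewrite -(Fp_eq p_prime) natrD !Fp_mod // !natrM !Fp_natK -!expr2 Ek.
exists (point k1 x j j'), (point k2 y 0 0); split.
- by rewrite ltn_mod.
- by rewrite ltn_mod.
- by apply/dsetP; exists k1, x, j, j'.
- by apply/dsetP; exists k2, y, 0, 0.
rewrite -EN /point modnDm -/Y1 -/Y2 (divn_eq N q) -/u -/v /T; congr (_ %% _).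
rewrite !mul0n !addn0 [RHS](_ : _ = (u + p) + q * (v + p)); last by lia.
by rewrite -Ej -Ej' !mulnDr; lia.
Qed.

Definition fibre (nu k1 k2 j j' i i' e e' : nat) : seq nat :=
  let N := nu + (q * q - 1) * ((j + i) * p + q * ((j' + i') * p)) in
  let U := (N %% q + e * q)%:R%R : 'F_p in
  let V := ((N %/ q %% q + e' * q)%:R - e%:R)%R : 'F_p in
  [seq point k1 (x : 'F_p) j j' |
     x <- Froots (k1 + k2)%:R%R (- (2 * k2%:R * U))%R (k2%:R * U ^+ 2 - V)%R].

Definition fibres (nu : nat) : seq nat :=
  flatten [seq flatten [seq flatten [seq flatten [seq flatten [seq flatten
    [seq flatten [seq flatten [seq fibre nu k1 k2 j j' i i' e e'
      | e' <- iota 0 2] | e <- iota 0 2] | i' <- iota 0 3] | i <- iota 0 3]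
      | j' <- iota 0 3] | j <- iota 0 3] | k2 <- kset p] | k1 <- kset p].

Lemma size_fibres nu : size (fibres nu) <= 5832.
Proof.
have -> : 5832 = 2 * 2 * 2 * 3 * 3 * 3 * 3 * 3 * 3 by [].
apply: size_flatten_map => k1 k1S; apply: size_flatten_map => k2 k2S.
do 6!apply: size_flatten_map => ? _.
by rewrite size_map size_Froots // ksetD_neq0.
Qed.

Lemma mem_fibres nu a b : dset p a -> dset p b -> a + b = nu %[mod q * q] ->
  a \in fibres nu.
Proof.
have /andP[pq qp] := p_lt_q; have q0 : 0 < q by lia.
case/dsetP=> k1 [x [j [j' [k1S lx lj lj' ->]]]].
case/dsetP=> k2 [y [i [i' [k2S ly li li' ->]]]].
rewrite /point modnDm; set Y1 := _ %% p; set Y2 := (_ * (y * y)) %% p => E.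
have lY1 : Y1 < p by rewrite ltn_mod; lia.
have lY2 : Y2 < p by rewrite ltn_mod; lia.
pose T := (j + i) * p + q * ((j' + i') * p).
have E1 : (x + y + q * (Y1 + Y2)) + T = nu %[mod q * q].
  by rewrite -E /T !mulnDr !mulnDl !mulnDr; congr (_ %% _); lia.
have {E1} := modn_subr _ E1; rewrite muln_gt0 q0 => /(_ isT).
rewrite /T; set N := nu + _ => EN.
have Eu : (x + y) %% q = N %% q.
  have := congr1 (modn^~ q) EN; rewrite !modn_dvdm ?dvdn_mulr //.
  by rewrite mulnC addnC modnMDl.
pose e := (x + y) %/ q; pose e' := (Y1 + Y2 + e) %/ q.
have le2 : e < 2 by rewrite ltn_divLR //; clear -lx ly pq; lia.
have le2' : e' < 2 by rewrite ltn_divLR //; clear -lY1 lY2 le2 pq; lia.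
have Ev : (Y1 + Y2 + e) %% q = N %/ q %% q.
  have := congr1 (divn^~ q) EN; rewrite -!modn_divl.
  by rewrite mulnC addnC divnMDl.
have EU : x + y = N %% q + e * q by rewrite -Eu [RHS]addnC; apply: divn_eq.
have EV : Y1 + Y2 + e = N %/ q %% q + e' * q by rewrite -Ev [RHS]addnC;
  apply: divn_eq.
apply/flatten_mapP; exists k1 => //.
apply/flatten_mapP; exists k2 => //.
apply/flatten_mapP; exists j; first by rewrite mem_iota.
apply/flatten_mapP; exists j'; first by rewrite mem_iota.
apply/flatten_mapP; exists i; first by rewrite mem_iota.
apply/flatten_mapP; exists i'; first by rewrite mem_iota.
apply/flatten_mapP; exists e; first by rewrite mem_iota.
apply/flatten_mapP; exists e'; first by rewrite mem_iota.
rewrite /fibre -/N -EU -EV; apply/mapP; exists (x%:R%R : 'F_p); last first.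
  by rewrite val_Fp_nat // (modn_small lx).
rewrite /Froots mem_filter mem_enum andbT !natrD (Fp_mod p_prime)
  (Fp_mod p_prime) !natrM.
apply/eqP; ring.
Qed.

End DigitSet.

(** * Representations *)

Definition digits_ok (k n : nat) : Prop :=
  forall i, i < k -> dset (dprime i) (digit_of n i).

Lemma expn2_gt0 m : 0 < 2 ^ m. Proof. by rewrite expn_gt0. Qed.

Lemma digit_ofE n i : digit_of n i = (n %% 2 ^ dpos i.+1) %/ 2 ^ dpos i.
Proof. by rewrite /digit_of modn_divl -expnD addnC -dposS. Qed.

Lemma digit_of_mod n i k : i < k -> digit_of (n %% 2 ^ dpos k) i = digit_of n i.
Proof.
by move=> lt; rewrite !digit_ofE modn_dvdm // dvdn_exp2l // dpos_mono.
Qed.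

Lemma expn_dposS k : 2 ^ dpos k.+1 =
  2 ^ dpos k * (2 ^ dlen (dprime k) * 2 ^ dlen (dprime k)).
Proof. by rewrite dposS expnD mul2n -addnn expnD. Qed.

Lemma digit_of_high a al k : a < 2 ^ dpos k ->
  al < 2 ^ dlen (dprime k) * 2 ^ dlen (dprime k) ->
  digit_of (a + 2 ^ dpos k * al) k = al.
Proof.
move=> la lal; rewrite /digit_of mulnC addnC divnMDl ?expn2_gt0 //.
by rewrite (divn_small la) addn0 mul2n -addnn expnD modn_small.
Qed.

Lemma digit_of_low a al k i : a < 2 ^ dpos k -> i < k ->
  digit_of (a + 2 ^ dpos k * al) i = digit_of a i.
Proof.
move=> la lt; rewrite -(digit_of_mod _ lt) mulnC addnC modnMDl digit_of_mod //.
Qed.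

Lemma digits_cover n k : exists a b, [/\ a < 2 ^ dpos k, b < 2 ^ dpos k,
  digits_ok k a, digits_ok k b & a + b = n %[mod 2 ^ dpos k]].
Proof.
elim: k => [|k [a [b [la lb oka okb E]]]].
  by exists 0, 0; split; rewrite /dpos ?big_geq // !modn1.
have M0 := expn2_gt0 (dpos k); have EM := expn_dposS k.
have low c al : c < 2 ^ dpos k -> digits_ok k c ->
    al < 2 ^ dlen (dprime k) * 2 ^ dlen (dprime k) -> dset (dprime k) al ->
    c + 2 ^ dpos k * al < 2 ^ dpos k.+1 /\ digits_ok k.+1 (c + 2 ^ dpos k * al).
  move=> lc okc lal Dal; split.
    by rewrite EM; apply: (@leq_trans (2 ^ dpos k * al.+1));
       [rewrite mulnS ltn_add2r | rewrite leq_mul2l lal orbT].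
  move=> i; rewrite ltnS leq_eqVlt => /predU1P[->|lt];
    first by rewrite digit_of_high.
  by rewrite digit_of_low //; apply: okc.
set M := 2 ^ dpos k in la lb E M0 EM low *.
set Q := 2 ^ dlen (dprime k) * _ in EM low *.
have Q0 : 0 < Q by rewrite muln_gt0 !expn2_gt0.
have leMQ : M <= M * Q by rewrite leq_pmulr.
have /dvdnP[nu Enu] : M %| (n + 2 * Q * M) - (a + b).
  by rewrite -eqn_mod_dvd; [rewrite E addnC modnMDl | lia].
have [al [be [lal lbe Dal Dbe Eab]]] :=
  dset_cover (dprime_prime k) (dprime_gt10 k) nu.
have [la' oka'] := low _ _ la oka lal Dal.
have [lb' okb'] := low _ _ lb okb lbe Dbe.
exists (a + M * al), (b + M * be); split=> //.
rewrite EM addnACA -mulnDr -modnDmr -muln_modr Eab muln_modr modnDmr mulnC -Enu.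
rewrite subnKC; last by clear -la lb leMQ Q0; lia.
by rewrite addnC -mulnA [Q * M]mulnC modnMDl.
Qed.

Lemma level_exists L : exists k,
  (k = 0 \/ dpos k + 2 <= L) /\ L < dpos k.+1 + 2.
Proof.
have ex : exists k, L < dpos k.+1 + 2 by exists L; have := leq_dpos L.+1; lia.
case: (ex_minnP ex) => k lt min; exists k; split=> //.
case: k lt min => [|k] lt min; [by left | right].
by rewrite leqNgt; apply/negP => /min; rewrite ltnn.
Qed.

Lemma size_binary n : size (binary n) = (trunc_log 2 n).+1.
Proof. by rewrite /binary size_rev size_map size_iota. Qed.

Lemma size_binary_mono m n : m <= n -> size (binary m) <= size (binary n).
Proof. by move=> le; rewrite !size_binary ltnS leq_trunc_log. Qed.

Lemma ltn_size_binary n : n < 2 ^ size (binary n).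
Proof. by rewrite size_binary trunc_log_ltn. Qed.

Lemma leq_size_binary n : 1 < size (binary n) -> 2 ^ (size (binary n) - 1) <= n.
Proof.
rewrite size_binary subn1 /= => H; apply: trunc_logP => //.
by case: n H => //; rewrite trunc_log0.
Qed.

Lemma basis_digits n k : k = 0 \/ dpos k + 2 <= size (binary n) -> n \in basis ->
  digits_ok k n.
Proof.
move=> H /basisP bn i lt; apply: bn; case: H => [E|]; first by rewrite E in lt.
by apply: leq_trans; rewrite leq_add2r dpos_mono.
Qed.

Lemma digits_basis n m k : size (binary n) <= m -> m < dpos k.+1 + 2 ->
  digits_ok k n -> n \in basis.
Proof.
move=> le lt ok; apply/basisP => i lei; apply: ok; rewrite ltnNge;
  apply/negP => leki.
have : dpos k.+1 <= dpos i.+1 by apply: dpos_mono.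
lia.
Qed.

Lemma basis_cover n : 0 < sigma basis n.
Proof.
have [k [k0 ltk]] := level_exists (size (binary n)).
have [a [b [la lb oka okb E]]] := digits_cover n k.
have le : a + b <= n.
  case: k0 => [k0|lek].
    by move: la lb; rewrite k0 /dpos big_geq //; lia.
  apply: leq_trans (_ : 2 ^ (dpos k).+1 <= n); first by rewrite expnS; lia.
  apply: leq_trans (leq_size_binary _); last by lia.
  by rewrite leq_exp2l //; lia.
have /dvdnP[m Em] : 2 ^ dpos k %| n - (a + b).
  by rewrite -eqn_mod_dvd // E.
pose a' := a + 2 ^ dpos k * m.
have Eab : a' + b = n by rewrite /a' mulnC -Em; lia.
have la' : a' <= n by lia.
have lb' : b <= n by lia.
apply/card_gt0P; exists (Ordinal (la' : a' < n.+1), Ordinal (lb' : b < n.+1)).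
rewrite inE /= Eab eqxx andbT; apply/andP; split.
  apply: (digits_basis _ ltk) (_ : digits_ok k a'); first exact: size_binary_mono.
  by move=> i lt; rewrite digit_of_low //; apply: oka.
by apply: (digits_basis _ ltk) okb; apply: size_binary_mono.
Qed.

Fixpoint low_parts (n k : nat) : seq nat :=
  if k is k'.+1 then
    let M := 2 ^ dpos k' in
    flatten [seq [seq b + M * be |
        be <- fibres (dprime k') ((n - (n + M - b) %% M - b) %/ M)]
      | b <- low_parts n k']
  else [:: 0].

Lemma size_low_parts n k : size (low_parts n k) <= 5832 ^ k.
Proof.
elim: k => // k IH; rewrite expnS; apply: (@leq_trans (5832 * size (low_parts n k))).
  apply: size_flatten_map => b _; rewrite size_map.
  exact: size_fibres (dprime_prime k) (dprime_gt10 k) _.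
by rewrite leq_mul2l IH orbT.
Qed.

Lemma mem_low_parts n k a b : a + b = n -> digits_ok k a -> digits_ok k b ->
  b %% 2 ^ dpos k \in low_parts n k.
Proof.
move=> E; elim: k => [|k IH] oka okb; first by rewrite /dpos big_geq // modn1.
have {}IH := IH (fun i lt => oka i (ltnW lt)) (fun i lt => okb i (ltnW lt)).
have M0 := expn2_gt0 (dpos k); have EM := expn_dposS k.
have Da := oka k (ltnSn k); have Db := okb k (ltnSn k).
apply/flatten_mapP; exists (b %% 2 ^ dpos k) => //.
apply/mapP; exists (digit_of b k).
  apply: (mem_fibres (dprime_prime k) (dprime_gt10 k) Db Da).
  rewrite /digit_of mul2n -addnn expnD modnDm; congr (_ %% _).
  set M := 2 ^ dpos k in M0 *.
  have Ea := divn_eq a M; have Eb := divn_eq b M.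
  have lb : b %% M < M by rewrite ltn_mod.
  have -> : (n + M - b %% M) %% M = a %% M.
    rewrite (_ : n + M - b %% M = (b %/ M + 1) * M + a) ?modnMDl //.
    by rewrite mulnDl; lia.
  rewrite (_ : n - _ - _ = (b %/ M + a %/ M) * M) ?mulnK //.
  rewrite mulnDl; move: Ea Eb.
  by move: (a %% M) (a %/ M * M) (b %% M) (b %/ M * M) => ? ? ? ? Ea Eb;
    clear -E Ea Eb; lia.
rewrite digit_ofE [LHS](divn_eq _ (2 ^ dpos k)) addnC mulnC; congr (_ + _).
by rewrite modn_dvdm // EM dvdn_mulr.
Qed.

Definition small_parts (n K : nat) : seq nat :=
  flatten [seq flatten [seq [seq b + 2 ^ dpos k * t |
      t <- iota 0 (2 * (2 ^ dlen (dprime k) * 2 ^ dlen (dprime k)))]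
    | b <- low_parts n k] | k <- iota 0 K.+1].

Lemma size_small_parts n K : size (small_parts n K) <= 968 * 46656 ^ K.
Proof.
apply: (@leq_trans (2 * ((11 * K.+1) * 2) ^ 2 * 5832 ^ K * size (iota 0 K.+1))).
  apply: size_flatten_map => k; rewrite mem_iota add0n ltnS => lek.
  apply: (@leq_trans (2 * ((11 * K.+1) * 2) ^ 2 * size (low_parts n k))).
    apply: size_flatten_map => b _; rewrite size_map size_iota leq_mul2l /= -expnD.
    rewrite addnn -muln2 expnM leq_exp2r //.
    have /andP[_ le] := dlen_bounds (leq_trans (isT : 0 < 11) (dprime_gt10 k)).
    by apply: leq_trans le _; have := dprime_le k; lia.
  rewrite leq_mul2l; apply/orP; right; apply: leq_trans (size_low_parts n k) _.
  by rewrite leq_exp2l.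
have le2 : K.+1 <= 2 ^ K by apply: ltn_expl.
have -> : 46656 ^ K = 5832 ^ K * (2 ^ K * 2 ^ K * 2 ^ K) by rewrite -!expnMn.
rewrite size_iota (_ : _ * _ = 968 * (5832 ^ K * (K.+1 * K.+1 * K.+1))); last by lia.
by rewrite leq_mul2l /= leq_mul2l !leq_mul ?orbT.
Qed.

Lemma mem_small_parts n K a b : size (binary n) < dpos K.+1 + 2 ->
  a + b = n -> b <= a -> a \in basis -> b \in basis -> b \in small_parts n K.
Proof.
move=> ltK E leba Ba Bb.
have [k [k0 ltk]] := level_exists (size (binary b)).
have lena := size_binary_mono leba.
have lenn : size (binary b) <= size (binary n) by apply: size_binary_mono; lia.
apply/flatten_mapP; exists k.
  rewrite mem_iota leq0n add0n /= ltnS leqNgt; apply/negP => ltKk.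
  have : dpos K.+1 <= dpos k by apply: dpos_mono.
  by case: k0; lia.
apply/flatten_mapP; exists (b %% 2 ^ dpos k).
  apply: (mem_low_parts E); last exact: basis_digits Bb.
  by apply: basis_digits Ba; case: k0 => [->|le]; [left | right; lia].
apply/mapP; exists (b %/ 2 ^ dpos k); last by rewrite addnC mulnC -divn_eq.
rewrite mem_iota add0n ltn_divLR ?expn2_gt0 //.
apply: leq_trans (ltn_size_binary b) _.
rewrite -mulnA [_ * 2 ^ dpos k]mulnC -expn_dposS -expnS leq_exp2l //; lia.
Qed.

Lemma sigma_le n K : size (binary n) < dpos K.+1 + 2 ->
  sigma basis n <= 2 * (968 * 46656 ^ K).
Proof.
move=> ltK; have sizeL := size_small_parts n K.
have memL a b := @mem_small_parts n K a b ltK.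
move: (small_parts n K) (968 * _) sizeL memL => L c sizeL memL.
rewrite /sigma; set S := [set p | _].
have H (X : {set 'I_n.+1 * 'I_n.+1}) (f : 'I_n.+1 * 'I_n.+1 -> nat) :
    {in X &, injective f} -> (forall x, x \in X -> f x \in L) -> #|X| <= c.
  move=> fI fX; apply: leq_trans sizeL.
  rewrite cardE -(size_map f); apply: uniq_leq_size.
    by rewrite map_inj_in_uniq ?enum_uniq // => x y; rewrite !mem_enum; apply: fI.
  by move=> _ /mapP[x + ->]; rewrite mem_enum; apply: fX.
rewrite -(cardsID [set p : 'I_n.+1 * 'I_n.+1 | p.2 <= p.1] S) mul2n -addnn.
apply: leq_add.
  apply: (H _ (fun p => p.2 : nat)) => [[a b] [a' b']|[a b]]; rewrite !inE /=.
    move=> /andP[/and3P[_ _ /eqP E] _] /andP[/and3P[_ _ /eqP E'] _] Eb.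
    by congr (_, _); apply: val_inj => //=; clear -E E' Eb; lia.
  by case/andP=> /and3P[Ba Bb /eqP E] le; apply: memL Ba Bb.
apply: (H _ (fun p => p.1 : nat)) => [[a b] [a' b']|[a b]]; rewrite !inE /=.
  move=> /andP[_ /and3P[_ _ /eqP E]] /andP[_ /and3P[_ _ /eqP E']] Eb.
  by congr (_, _); apply: val_inj => //=; clear -E E' Eb; lia.
case/andP=> lt /and3P[Ba Bb /eqP E].
by apply: memL Bb Ba; [rewrite addnC | clear -lt; lia].
Qed.

(** * Growth of the digit lengths *)

Lemma expn2_leq_bin m n : n <= m -> 2 ^ n <= 'C(m + n, n).
Proof.
elim: n => [|n IH] lt; first by rewrite bin0.
rewrite addnS -(leq_pmul2l (ltn0Sn n)) -mul_bin_diag expnS mulnA.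
by apply: leq_mul; [lia | apply: IH; apply: ltnW].
Qed.

Lemma logn_central_bin p n : prime p -> 0 < n ->
  p ^ logn p 'C(n + n, n) <= n + n.
Proof.
move=> pp n0; have p1 := prime_gt1 pp.
apply: (@leq_trans (p ^ trunc_log p (n + n))); last by apply: trunc_logP; lia.
rewrite leq_exp2l //; set T := trunc_log p (n + n).
have lef : n <= n + n by rewrite leq_addr.
have := congr1 (logn p) (bin_fact lef).
rewrite addKn !lognM ?muln_gt0 ?fact_gt0 ?bin_gt0 // !logn_fact //.
set S := \sum_(1 <= k < n.+1) _.
have ES : S = \sum_(1 <= k < (n + n).+1) n %/ p ^ k.
  rewrite [RHS](@big_cat_nat _ _ _ n.+1) //=.
  rewrite [X in _ + X]big1_seq ?addn0 // => k.
  rewrite mem_index_iota => /andP[_ /andP[lt _]].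
  by rewrite divn_small //; apply: leq_trans lt (ltnW (ltn_expl _ p1)).
have le : \sum_(1 <= k < (n + n).+1) (n + n) %/ p ^ k <=
          \sum_(1 <= k < (n + n).+1) ((n %/ p ^ k + n %/ p ^ k) + (k <= T)).
  rewrite big_nat_cond [leqRHS]big_nat_cond;
    apply: leq_sum => k /andP[/andP[k1 _] _].
  have pk0 : 0 < p ^ k by rewrite expn_gt0 ltnW.
  case: (leqP k T) => [_|ltT].
    rewrite -ltnS ltn_divLR // [in X in X < _](divn_eq n (p ^ k)).
    have := ltn_pmod n pk0; set r := n %% _; set x := n %/ _ => lt.
    by rewrite !mulSn !mulnDl; lia.
  rewrite divn_small // (leq_trans (trunc_log_ltn (n + n) p1)) //.
  by rewrite leq_exp2l.
rewrite !big_split /= -ES in le => E; rewrite -E in le.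
have leT m : \sum_(1 <= k < m.+1) (k <= T) = minn m T.
  elim: m => [|m IH]; first by rewrite big_geq ?min0n.
  by rewrite big_nat_recr //= IH; case: leqP; lia.
by rewrite leT in le; lia.
Qed.

Lemma central_bin_le n P : 0 < n -> (forall p, prime p -> p <= n + n -> p <= P) ->
  'C(n + n, n) <= (n + n) ^ P.
Proof.
move=> n0 HP; have C0 : 0 < 'C(n + n, n) by rewrite bin_gt0 leq_addr.
rewrite (prod_prime_decomp C0) prime_decompE big_map /=.
apply: (@leq_trans (\prod_(p <- primes 'C(n + n, n)) (n + n))).
  rewrite big_seq [leqRHS]big_seq; apply: leq_prod => p.
  by rewrite mem_primes => /and3P[pp _ _]; apply: logn_central_bin.
rewrite big_const_seq count_predT iter_muln_1 leq_pexp2l ?addn_gt0 ?n0 //.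
rewrite -[P](size_iota 1); apply: uniq_leq_size (primes_uniq _) _ => p.
rewrite mem_primes => /and3P[pp _ dvd]; rewrite mem_iota add1n ltnS prime_gt0 //=.
apply: HP => //; apply: leq_trans (logn_central_bin pp n0).
by rewrite -{1}(expn1 p) leq_exp2l ?prime_gt1 // logn_gt0 mem_primes pp C0.
Qed.

Lemma sqr_leq_expn2 t : t * t <= 2 ^ t.+1.
Proof.
case: (ltnP t 4) => [|le]; first by case: t => [|[|[|[|]]]].
rewrite expnS; rewrite -(subnKC le); elim: (t - 4) => [|m IH] //.
by rewrite addnS expnS; lia.
Qed.

Lemma prime_bound n P : (forall p, prime p -> p <= n + n -> p <= P) ->
  n <= 8 * (P * P).
Proof.
case: (posnP n) => [-> //|n0] HP.
set t := (trunc_log 2 (n + n)).+1.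
have lt_t : n + n < 2 ^ t by apply: trunc_log_ltn.
have le_t : 2 ^ t <= 2 * (n + n).
  by rewrite /t expnS leq_mul2l /=; apply: trunc_logP; lia.
have le_n : n <= t * P.
  rewrite -(leq_exp2l (m := 2)) //; apply: leq_trans (expn2_leq_bin (leqnn n)) _.
  apply: leq_trans (central_bin_le n0 HP) _; rewrite expnM.
  by case: (P) => // P'; rewrite leq_exp2r // ltnW.
have := sqr_leq_expn2 t; rewrite expnS => le_tt.
rewrite -(leq_pmul2l n0); apply: (@leq_trans ((t * P) * (t * P)));
  first exact: leq_mul.
rewrite mulnACA [leqRHS]mulnA leq_mul2r; apply/orP; right; lia.
Qed.

Lemma dprime_lower j : j <= 17 * (dprime j * dprime j).
Proof.
have gt10 := dprime_gt10 j; set n := j.-1./2.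
have : n <= 8 * (dprime j * dprime j).
  apply: prime_bound => p pp lep; case: (leqP p 10) => [le10|gtp].
    exact: leq_trans le10 (ltnW gt10).
  by apply: dprime_max => //; rewrite gtp; move: lep; rewrite /n; lia.
have : 0 < dprime j * dprime j by rewrite muln_gt0 !(leq_trans _ gt10).
by rewrite /n; lia.
Qed.

Lemma dpos_lower K t : 34 * 2 ^ t <= K -> K * t <= 2 * dpos K.
Proof.
move=> leK; rewrite /dpos (@big_cat_nat _ _ _ K./2) //=; last by lia.
apply: (@leq_trans (2 * \sum_(K./2 <= j < K) t)).
  by rewrite sum_nat_const_nat; lia.
rewrite leq_mul2l /=; apply: leq_trans (leq_addl _ _).
rewrite big_nat_cond [leqRHS]big_nat_cond; apply: leq_sum => j /andP[/andP[lej _] _].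
have lo := dprime_lower j.
have /andP[lt _] := dlen_bounds (leq_trans (isT : 0 < 11) (dprime_gt10 j)).
rewrite -(leq_exp2l (m := 2)) // mul2n -addnn expnD.
rewrite -(leq_pmul2l (isT : 0 < 17)); apply: (@leq_trans j); first by lia.
by apply: leq_trans lo _; rewrite leq_mul2l /= leq_mul // ltnW.
Qed.

Local Open Scope ring_scope.

Section Growth.
Variable R : realType.
Implicit Types x : R.

Lemma ln2_bounds : 1 / 2 <= ln 2 :> R /\ ln 2 <= 1 :> R.
Proof.
split.
  have := @le_ln1Dx R (- (1 / 2)); rewrite (_ : 1 + _ = 2^-1); last by field.
  by rewrite lnV ?posrE // => /(_ _); lra.
by have := @le_ln1Dx R 1; rewrite (_ : 1 + 1 = 2) //; lra.
Qed.

Lemma ln3_gt1 : 1 < ln 3 :> R.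
Proof.
have H : ln (5 / 6) <= - (1 / 6) :> R.
  by have := @le_ln1Dx R (- (1 / 6)); rewrite (_ : 1 + _ = 5 / 6); [lra | field].
have E : ln (6 / 5) = - ln (5 / 6) :> R.
  by rewrite -lnV ?posrE; [congr ln; field | lra].
have : ln ((6 / 5) ^+ 6) < ln 3 :> R by rewrite ltr_ln ?posrE; lra.
rewrite lnXn; last by lra.
by rewrite E -[_ *+ 6]mulr_natl; lra.
Qed.

Lemma ln_nat_pow2 (n m : nat) : (2 ^ m <= n)%N -> m%:R * ln 2 <= ln n%:R :> R.
Proof.
move=> le; have le' : (2 : R) ^+ m <= n%:R by rewrite -natrX ler_nat.
have p2 : 0 < (2 : R) ^+ m by rewrite exprn_gt0.
rewrite mulr_natl -lnXn // ler_ln ?posrE //.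
exact: lt_le_trans le'.
Qed.

Lemma level_le (n K : nat) : (3 <= n)%N ->
  K = 0%N \/ (dpos K + 2 <= size (binary n))%N ->
  K%:R <= 68 + 64 * (ln n%:R / ln (ln n%:R)) :> R.
Proof.
move=> n3 HK; set x : R := ln n%:R.
have x1 : 1 < x.
  apply: lt_le_trans ln3_gt1 _.
  by rewrite ler_ln ?posrE ?ltr0n ?ler_nat //; apply: leq_trans n3.
have x0 : 0 < x by lra.
have lx0 : 0 < ln x by apply: ln_gt0.
have quo0 : 0 <= x / ln x by rewrite divr_ge0 // ltW.
have [le68|gt68] := leqP K 68.
  have h : K%:R <= 68 :> R by rewrite (ler_nat _ K 68).
  by apply: le_trans h _; rewrite lerDl mulr_ge0.
suff : K%:R * ln x <= 64 * x.
  rewrite -(ler_pdivlMr _ _ lx0) -mulrA => H; lra.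
have K1 : 1 <= K%:R :> R by rewrite (ler_nat _ 1); apply: leq_trans gt68.
have [leKx|ltxK] := leP (K%:R ^+ 2) x.
  have lnK : ln K%:R <= K%:R :> R by apply/ltW/ln_sublinear; lra.
  have : ln x <= x / K%:R ^+ 2 + 2 * ln K%:R.
    have K20 : 0 < K%:R ^+ 2 :> R by apply: exprn_gt0; lra.
    have -> : x = x / K%:R ^+ 2 * K%:R ^+ 2 by rewrite divfK // gt_eqF.
    rewrite lnM ?posrE // ?divr_gt0 // lnXn; last lra.
    rewrite mulfK ?gt_eqF // -[_ *+ 2]mulr_natl lerD2r.
    by apply/ltW/ln_sublinear; rewrite divr_gt0.
  set y := x / _ => le_lnx.
  have y0 : 0 <= y by rewrite divr_ge0 ?exprn_ge0 // ltW.
  have Ey : K%:R * (K%:R * y) = x.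
    by rewrite mulrA -expr2 mulrC divfK // gt_eqF // exprn_gt0 //; lra.
  have h1 : K%:R * y <= K%:R * (K%:R * y) by rewrite ler_peMl // mulr_ge0.
  have h2 : K%:R * ln K%:R <= K%:R * K%:R :> R by rewrite ler_wpM2l.
  have h3 : K%:R * ln x <= K%:R * (y + 2 * ln K%:R) by rewrite ler_wpM2l.
  by rewrite expr2 in leKx; lra.
set t := trunc_log 2 (K %/ 34).
have t1 : 1 <= t%:R :> R.
  by rewrite (ler_nat _ 1) trunc_log_gt0 /= leq_divRL //; lia.
have leK : (34 * 2 ^ t <= K)%N.
  by rewrite mulnC -leq_divRL //; apply: trunc_logP; rewrite // divn_gt0 //; lia.
have ltK : (K <= 2 ^ (t + 7))%N.
  have := @trunc_log_ltn 2 (K %/ 34) isT; rewrite -/t ltn_divLR // expnD expnS.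
  by move=> lt; apply: leq_trans (ltnW lt) _; rewrite -mulnA mulnCA leq_mul2l orbT.
have lnK : ln K%:R <= t%:R + 7 :> R.
  have h : ln K%:R <= ln (2 ^+ (t + 7)) :> R.
    rewrite ler_ln ?posrE ?exprn_gt0 //; last lra.
    by rewrite -natrX ler_nat.
  apply: le_trans h _; rewrite lnXn // -[_ *+ (t + 7)]mulr_natl natrD.
  by rewrite ler_piMr ?addr_ge0 //; case: ln2_bounds.
have lnx : ln x <= 2 * ln K%:R.
  rewrite mulr_natl -lnXn; last lra.
  by rewrite ler_ln ?posrE //; [apply: ltW | apply: exprn_gt0; lra].
set m := trunc_log 2 n.
have le_dm : (dpos K <= m)%N.
  by case: HK => [E|]; [rewrite E in gt68 | rewrite size_binary -/m; lia].
have le_mx : m%:R <= 2 * x.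
  have := @ln_nat_pow2 n m; rewrite trunc_logP ?(leq_trans _ n3) // => /(_ isT).
  rewrite -/x => h; have [l2 _] := ln2_bounds.
  have : m%:R * (1 / 2) <= m%:R * ln 2 :> R by rewrite ler_wpM2l.
  lra.
have hd : K%:R * t%:R <= 2 * m%:R :> R.
  rewrite -!natrM ler_nat; apply: leq_trans (dpos_lower leK) _.
  by rewrite leq_mul2l.
have h3 : K%:R * ln x <= K%:R * (16 * t%:R) by rewrite ler_wpM2l //; lra.
lra.
Qed.

End Growth.

Theorem theorem1p1 (R : realType) :
  exists (A : {pred nat}) (C c : R),
    [/\ polytime_decidable A,
        0 < C,
        0 < c,
        forall n : nat, (1 <= sigma A n)%N
      & forall n : nat, (3 <= n)%N ->
          (sigma A n)%:R <= C * n%:R `^ (c / ln (ln n%:R))].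
Proof.
have [B B1 HB] : exists2 B : nat, (1 < B)%N & exists D : nat, forall n K,
    (size (binary n) < dpos K.+1 + 2)%N -> (sigma basis n <= D * B ^ K)%N.
  by exists 46656%N => //; exists (2 * 968)%N => n K; rewrite -mulnA;
    apply: sigma_le.
case: HB => D HD.
have lnB : 0 < ln B%:R :> R by rewrite ln_gt0 // (ltr_nat _ 1).
exists basis, (D.+1%:R * expR (68 * ln B%:R)), (64 * ln B%:R); split.
- exact: basis_polytime.
- by rewrite mulr_gt0 ?expR_gt0.
- by rewrite mulr_gt0.
- exact: basis_cover.
move=> n n3; have [K [HK ltK]] := level_exists (size (binary n)).
have leK := level_le R n3 HK.
apply: (@le_trans _ _ (D.+1%:R * B%:R ^+ K)).
  rewrite -natrX -natrM ler_nat; apply: leq_trans (HD n K ltK) _.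
  by rewrite leq_mul2r leqnSn orbT.
have B0 : 0 < B%:R :> R by rewrite ltr0n; apply: ltnW.
have n0 : n%:R != 0 :> R by rewrite pnatr_eq0; case: (n) n3.
rewrite -mulrA ler_pM2l ?ltr0n // /powR (negPf n0) -expRD.
rewrite -[B%:R]lnK ?posrE // -expRM_natl ler_expR expRK.
apply: le_trans (_ : (68 + 64 * (ln n%:R / ln (ln n%:R))) * ln B%:R <= _).
  by rewrite ler_pM2r.
rewrite mulrDl lerD2l le_eqVlt; apply/orP; left; apply/eqP; ring.
Qed.
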